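(* Let $\Lambda$ be a finite dimensional algebra over an algebraically closed field $\mathbb{K}$. Let $\mathcal{C}$ be a $2$-fold torsion class of $\mathsf{mod}\,\Lambda$ such that the smallest torsion class $T_1(\mathcal{C})$ of $\mathsf{mod}\,\Lambda$ containing $\mathcal{C}$ is functorially finite and $\mathcal{C}$ satisfies condition $( * )$. Then: (a) $\mathcal{C}$ is functorially finite in $\mathsf{mod}\,\Lambda$. (b) There exist subcategories $\mathcal{F}_1,\mathcal{F}_2$ of $\mathsf{mod}\,\Lambda$ such that $(\mathcal{C}, T_1(\mathcal{C});\mathcal{F}_2,\mathcal{F}_1)$ is a $2$-fold torsion pair of $\mathsf{mod}\,\Lambda$. (c) $\mathcal{C}$ admits an Ext-progenerator.
   Context: $\mathsf{mod}\,\Lambda$ is the category of finitely generated right $\Lambda$-modules; all subcategories are full and closed under isomorphisms. $\mathsf{add}\,M$ is the subcategory of finite direct sums of direct summands of $M$. Let $\mathcal{E}$ be an extension-closed subcategory of an abelian category $\mathcal{A}$. A conflation in $\mathcal{E}$ is a short exact sequence of $\mathcal{A}$ with all three terms in $\mathcal{E}$. A subcategory $\mathcal{S}\subset\mathcal{E}$ is a torsion class of $\mathcal{E}$ if for every conflation $0\to A\to B\to C\to0$ in $\mathcal{E}$: $A,C\in\mathcal{S}$ implies $B\in\mathcal{S}$, and $B\in\mathcal{S}$ implies $C\in\mathcal{S}$. A $2$-fold torsion class of $\mathcal{A}$ is a subcategory that is a torsion class of some torsion class of $\mathcal{A}$. A subcategory $\mathcal{X}$ of $\mathsf{mod}\,\Lambda$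 is functorially finite if every module has a left and a right $\mathcal{X}$-approximation. (A right $\mathcal{X}$-approximation of $M$ is a morphism $f\colon X\to M$ with $X\in\mathcal{X}$ through which every morphism from an object of $\mathcal{X}$ to $M$ factors; it is right minimal if every $g\in\mathrm{End}(X)$ with $fg=f$ is an isomorphism; left versions are dual.) For extension-closed $\mathcal{X}$, an object $P\in\mathcal{X}$ is an Ext-progenerator of $\mathcal{X}$ if $\mathrm{Ext}^1_\Lambda(P,X)=0$ for all $X\in\mathcal{X}$ and every $X\in\mathcal{X}$ admits a conflation $0\to T\to P'\to X\to0$ in $\mathcal{X}$ with $P'\in\mathsf{add}\,P$. Every functorially finite torsion class $\mathcal{T}$ of $\mathsf{mod}\,\Lambda$ has a basic Ext-progenerator, unique up to isomorphism, denoted $P(\mathcal{T})$ (basic: no direct summand $N\oplus N$ with $N$ indecomposable). Condition $( * )$: for every $C\in\mathcal{C}$ and the right minimal $(\mathsf{add}\,P(T_1(\mathcal{C})))$-approximation $P_C\to C$, one has $P_C\in\mathcal{C}$. For a subcategory $\mathcal{D}$ and $j\ge0$ put $\mathcal{D}^{\perp_j}=\{M\mid \mathrm{Ext}^j_\Lambda(D,M)=0\ \forall D\in\mathcal{D}\}$ and ${}^{\perp_j}\mathcal{D}=\{M\mid \mathrm{Ext}^j_\Lambda(M,D)=0\ \forall D\in\mathcal{D}\}$, with $\mathrm{Ext}^0=\mathrm{Hom}$. A quadruple $(\mathcal{T}_2,\mathcal{T}_1;\mathcal{F}_2,\mathcal{F}_1)$ of subcategories of $\mathsf{mod}\,\Lambda$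 is a $2$-fold torsion pair if $\mathcal{T}_1={}^{\perp_0}\mathcal{F}_1$, $\mathcal{T}_2={}^{\perp_0}\mathcal{F}_1\cap{}^{\perp_1}\mathcal{F}_2$, $\mathcal{F}_1=\mathcal{T}_1^{\perp_0}$ and $\mathcal{F}_2=\mathcal{T}_1^{\perp_0}\cap\mathcal{T}_2^{\perp_1}$. *)

(* Defs.v *)
From HB Require Import structures.
From mathcomp Require Import all_boot all_order all_algebra all_field.

Set Implicit Arguments.
Unset Strict Implicit.
Unset Printing Implicit Defensive.

Import GRing.Theory.
Local Open Scope ring_scope.

(* Everything is stated for left modules over a ring R, and used with the
   converse ring R := Lambda^c, whose left modules are the right
   Lambda-modules: a *: x in an lmodType Lambda^c is the right action x a. *)

Definition fin_gen (R : nzRingType) (M : lmodType R) : Prop :=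
  exists (n : nat) (v : 'I_n -> M),
    forall x : M, exists c : 'I_n -> R, x = \sum_(i < n) c i *: v i.

Record fgmod (R : nzRingType) := FgMod {
  fgmod_lmod :> lmodType R;
  fgmod_fin_gen : fin_gen fgmod_lmod }.

Section Modules.
Variable R : nzRingType.

Definition isom (M N : lmodType R) : Prop :=
  exists f : {linear M -> N}, bijective f.

Definition nonzero_mod (M : lmodType R) : Prop := exists x : M, x != 0.

Definition direct_summand (N M : lmodType R) : Prop :=
  exists N' : lmodType R, isom (N * N')%type M.

(* F 0 (+) ... (+) F (n - 1), starting from the zero module 'rV_0. *)
Fixpoint dsum (n : nat) (F : nat -> lmodType R) : lmodType R :=
  if n is n'.+1 then (dsum n' F * F n')%type : lmodType R
  else 'rV[R]_0 : lmodType R.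

Definition indecomposable (N : lmodType R) : Prop :=
  nonzero_mod N /\
  forall A B : lmodType R,
    isom (A * B)%type N -> ~ (nonzero_mod A /\ nonzero_mod B).

Definition basic (P : lmodType R) : Prop :=
  forall N : lmodType R, indecomposable N -> ~ direct_summand (N * N)%type P.

Definition short_exact (A B C : lmodType R)
    (i : {linear A -> B}) (p : {linear B -> C}) : Prop :=
  [/\ injective i,
      forall b : B, p b = 0 <-> exists a : A, i a = b
    & forall c : C, exists b : B, p b = c].

(* Yoneda equivalence of two short exact sequences 0 -> N -> E -> M -> 0. *)
Definition ext_equiv (N M E E' : lmodType R)
    (i : {linear N -> E}) (p : {linear E -> M})
    (i' : {linear N -> E'}) (p' : {linear E' -> M}) : Prop :=
  exists phi : {linear E -> E'},
    [/\ bijective phi, forall y : N, phi (i y) = i' y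
      & forall e : E, p' (phi e) = p e].

(* Ext^1(M, N) is the group of Yoneda classes of extensions of M by N, whose
   zero element is the class of 0 -> N -> N * M -> M -> 0, with maps
   split_inl and snd. *)
Definition split_inl (N M : lmodType R) (y : N) : (N * M)%type := (y, 0).

Fact split_inl_is_linear (N M : lmodType R) : linear (@split_inl N M).
Proof.
by move=> a x y; rewrite /split_inl; congr pair; rewrite /= scaler0 addr0.
Qed.

HB.instance Definition _ (N M : lmodType R) :=
  GRing.isLinear.Build R N (N * M)%type *:%R (@split_inl N M)
    (@split_inl_is_linear N M).

Definition Ext0_zero (M N : fgmod R) : Prop :=
  forall (f : {linear M -> N}) (x : M), f x = 0.

Definition Ext1_zero (M N : fgmod R) : Prop :=
  forall (E : fgmod R) (i : {linear N -> E}) (p : {linear E -> M}),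
    short_exact i p -> ext_equiv i p (@split_inl N M) (@snd N M).

End Modules.

(* Full subcategories are given by their classes of objects. *)
Definition subcat (R : nzRingType) := fgmod R -> Prop.

Section Subcategories.
Variable R : nzRingType.
Implicit Types (S T D E X : subcat R) (A B C M N P : fgmod R).

Definition iso_closed S : Prop := forall M N, isom M N -> S M -> S N.

Definition same_subcat S T : Prop := forall M, S M <-> T M.

Definition sub_subcat S T : Prop := forall M, S M -> T M.

Definition full_subcat : subcat R := fun=> True.

Definition cap_subcat S T : subcat R := fun M => S M /\ T M.

Definition conflation E A B C
    (i : {linear A -> B}) (p : {linear B -> C}) : Prop :=
  [/\ E A, E B, E C & short_exact i p].

Definition torsion_class E S : Prop :=
  [/\ iso_closed S, sub_subcat S E &
      forall A B C (i : {linear A -> B}) (p : {linear B -> C}),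
        conflation E i p -> (S A -> S C -> S B) /\ (S B -> S C)].

(* The intermediate class T is extension-closed, being a torsion class. *)
Definition twofold_torsion_class S : Prop :=
  exists T, torsion_class full_subcat T /\ torsion_class T S.

Definition T1 S : subcat R := fun M =>
  forall T, torsion_class full_subcat T -> sub_subcat S T -> T M.

Lemma T1_torsion_class S : torsion_class full_subcat (T1 S).
Proof.
split=> // [M N isoMN T1M T tT sST|A B C i p conf].
  by case: (tT) => isoT _ _; apply: isoT isoMN (T1M T tT sST).
split=> [T1A T1C|T1B] T tT sST; case: (tT) => _ _ /(_ _ _ _ _ _ conf)[extT quoT].
  by apply: extT; [apply: T1A | apply: T1C].
by apply: quoT; apply: T1B.
Qed.

Lemma sub_T1 S : sub_subcat S (T1 S).
Proof. by move=> M SM T _; apply. Qed.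

Lemma T1_min S T :
  torsion_class full_subcat T -> sub_subcat S T -> sub_subcat (T1 S) T.
Proof. by move=> tT sST M; apply. Qed.

Definition right_approx X M N (f : {linear N -> M}) : Prop :=
  X N /\ forall (N' : fgmod R) (h : {linear N' -> M}), X N' ->
           exists g : {linear N' -> N}, forall x, h x = f (g x).

Definition left_approx X M N (f : {linear M -> N}) : Prop :=
  X N /\ forall (N' : fgmod R) (h : {linear M -> N'}), X N' ->
           exists g : {linear N -> N'}, forall x, h x = g (f x).

Definition right_minimal M N (f : {linear N -> M}) : Prop :=
  forall g : {linear N -> N}, (forall x, f (g x) = f x) -> bijective g.

Definition functorially_finite X : Prop :=
  forall M,
    (exists N (f : {linear M -> N}), left_approx X f) /\
    (exists N (f : {linear N -> M}), right_approx X f).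

Definition add P : subcat R := fun M =>
  exists (n : nat) (F : nat -> lmodType R),
    (forall i, (i < n)%N -> direct_summand (F i) P) /\ isom (dsum n F) M.

Definition ext_progenerator X P : Prop :=
  [/\ X P,
      forall M, X M -> Ext1_zero P M &
      forall M, X M ->
        exists (T P' : fgmod R) (i : {linear T -> P'}) (p : {linear P' -> M}),
          add P P' /\ conflation X i p].

(* P(T_1(S)) is determined up to isomorphism, and so is the right minimal
   approximation, whence the quantification over all choices of both. *)
Definition condition_star S : Prop :=
  forall P, basic P -> ext_progenerator (T1 S) P ->
  forall M, S M ->
  forall (PM : fgmod R) (f : {linear PM -> M}),
    right_approx (add P) f -> right_minimal f -> S PM.

Definition right_perp0 D : subcat R := fun M => forall N, D N -> Ext0_zero N M.
Definition right_perp1 D : subcat R := fun M => forall N, D N -> Ext1_zero N M.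
Definition left_perp0 D : subcat R := fun M => forall N, D N -> Ext0_zero M N.
Definition left_perp1 D : subcat R := fun M => forall N, D N -> Ext1_zero M N.

Definition twofold_torsion_pair (T2 T1 F2 F1 : subcat R) : Prop :=
  [/\ same_subcat T1 (left_perp0 F1),
      same_subcat T2 (cap_subcat (left_perp0 F1) (left_perp1 F2)),
      same_subcat F1 (right_perp0 T1)
    & same_subcat F2 (cap_subcat (right_perp0 T1) (right_perp1 T2))].

End Subcategories.

(* Main.v *)
(* Write T = T_1(C). The generating step is this: if P generates a torsion class
   T and g : P -> Q is a left C-approximation with Q Ext-projective in C, then
   Q (+) coker g is an Ext-progenerator of C. With mod Lambda and T in place of T
   and C, and for a left T-approximation of Lambda of minimal dimension, it yields
   an Ext-progenerator of T; let P be one of minimal dimension, which is basic.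

   By condition (star), every M in C is the quotient of some Q^n by a module of T,
   where Q is the largest direct summand of P that lies in C. As P is
   Ext-projective in T, a left (add Q)-approximation of P is a left
   C-approximation, which gives (c). For M in T, pushing K -> P^n -> M out along a
   left C-approximation of P^n gives a left C-approximation of M, and dividing Q^n
   by the torsion part of the kernel of a right (add Q)-approximation Q^n -> M
   gives a right one. For (b), Fac C is closed under extensions because Q is
   Ext-projective in T, so T = Fac C and the right C-approximation X -> M is onto;
   its kernel lies in F_2, so it splits when Ext^1(M, F_2) = 0. *)

Require Import Defs.
From mathcomp Require Import all_boot all_order all_algebra all_field.
From HB Require Import structures.
From mathcomp Require Import boolp generic_quotient ring_quotient.

Set Implicit Arguments.
Unset Strict Implicit.
Unset Printing Implicit Defensive.

Import GRing.Theory.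
Local Open Scope ring_scope.

Definition surj (T U : Type) (f : T -> U) := forall y, exists x, f x = y.

Lemma bij_inj_surj (T U : Type) (f : T -> U) :
  injective f -> surj f -> bijective f.
Proof.
move=> injf surjf; have [g gE] := choice surjf.
by exists g => [x|//]; apply: injf; rewrite gE.
Qed.

Lemma bij_surj (T U : Type) (f : T -> U) : bijective f -> surj f.
Proof. by case=> g _ gK y; exists (g y). Qed.

(** * Kernels and cokernels *)

Section LinearMaps.
Variable R : nzRingType.
Implicit Types A B M N X Y : lmodType R.

Lemma linear_of_fun M N (f : M -> N) :
  linear f -> exists g : {linear M -> N}, forall x, g x = f x.
Proof.
move=> lf.
by exists (HB.pack f (GRing.isLinear.Build R M N *:%R f lf) : {linear M -> N}).
Qed.

Lemma lin_inj M N (f : {linear M -> N}) :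
  (forall x, f x = 0 -> x = 0) -> injective f.
Proof.
move=> f0 x y fxy; apply/eqP; rewrite -subr_eq0; apply/eqP/f0.
by rewrite linearB /= fxy subrr.
Qed.

Lemma linear_inverse M N (f : {linear M -> N}) :
  bijective f -> exists g : {linear N -> M}, cancel f g /\ cancel g f.
Proof.
case=> g fK gK; have lg : linear g.
  by move=> a x y; apply: (can_inj fK); rewrite linearP !gK.
by have [h hE] := linear_of_fun lg; exists h; split=> x; rewrite hE.
Qed.

Lemma factor_through_inj A B X (i : {linear A -> B}) (f : {linear X -> B}) :
  injective i -> (forall x, exists a, i a = f x) ->
  exists g : {linear X -> A}, forall x, i (g x) = f x.
Proof.
move=> inji /choice[g gE]; have lg : linear g.
  by move=> a x y; apply: inji; rewrite linearP !gE linearP.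
by have [h hE] := linear_of_fun lg; exists h => x; rewrite hE.
Qed.

Lemma factor_through_surj A B X (p : {linear A -> B}) (f : {linear A -> X}) :
  surj p -> (forall a, p a = 0 -> f a = 0) ->
  exists g : {linear B -> X}, forall a, g (p a) = f a.
Proof.
move=> /choice[s sE] pf; pose g := f \o s.
have gE a : g (p a) = f a.
  by apply/eqP; rewrite -subr_eq0 -linearB pf // linearB sE subrr.
have lg : linear g.
  by move=> c x y; rewrite -{1}[x]sE -{1}[y]sE -linearP gE linearP.
by have [h hE] := linear_of_fun lg; exists h => a; rewrite hE.
Qed.

Lemma linear_pair X A B (f : {linear X -> A}) (g : {linear X -> B}) :
  exists h : {linear X -> (A * B)%type}, forall x, h x = (f x, g x).
Proof.
have lh : linear (fun x => (f x, g x) : (A * B)%type).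
  by move=> a x y; rewrite !linearP.
by have [h hE] := linear_of_fun lh; exists h.
Qed.

Lemma linear_copair X A B (f : {linear A -> X}) (g : {linear B -> X}) :
  exists h : {linear (A * B)%type -> X}, forall x y, h (x, y) = f x + g y.
Proof. by exists ((f \o fst) \+ (g \o snd)). Qed.

Section Kernel.
Variables (M N : lmodType R) (f : {linear M -> N}).

Definition ker_pred : {pred M} := fun x => f x == 0.

Fact ker_pred_submod_closed : submod_closed ker_pred.
Proof.
split; first by rewrite unfold_in linear0.
by move=> a x y; rewrite !unfold_in linearP => /eqP-> /eqP->;
  rewrite scaler0 addr0.
Qed.

HB.instance Definition _ :=
  GRing.isSubmodClosed.Build R M ker_pred ker_pred_submod_closed.

Record ker_type := KerType { ker_val : M; _ : ker_val \in ker_pred }.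

HB.instance Definition _ := [isSub for ker_val].
HB.instance Definition _ := [Choice of ker_type by <:].
HB.instance Definition _ := [SubChoice_isSubLmodule of ker_type by <:].

End Kernel.

Lemma kernel_exists_lmod M N (f : {linear M -> N}) :
  exists (K : lmodType R) (i : {linear K -> M}),
    injective i /\ forall x, f x = 0 <-> exists a, i a = x.
Proof.
exists (ker_type f : lmodType R), (val : {linear ker_type f -> M}).
split; first exact: val_inj.
move=> x; split=> [fx0|[a <-]]; last by apply/eqP; exact: (valP a).
have kx : x \in ker_pred f by rewrite unfold_in fx0.
by exists (KerType kx).
Qed.

Section Cokernel.
Variables (A M : lmodType R) (f : {linear A -> M}).

Definition im_pred : {pred M} := fun x => `[< exists a, f a = x >].

Fact im_pred_zmod_closed : zmod_closed im_pred.
Proof.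
split; first by apply/asboolP; exists 0; rewrite linear0.
move=> x y /asboolP[a <-] /asboolP[b <-]; apply/asboolP.
by exists (a - b); rewrite linearB.
Qed.

HB.instance Definition _ :=
  GRing.isZmodClosed.Build M im_pred im_pred_zmod_closed.

Definition coker_type := @Quotient.quot M im_pred.
HB.instance Definition _ := GRing.Zmodule.on coker_type.

Definition coker_proj (x : M) : coker_type := (\pi_(@Quotient.quot M im_pred)
  x)%qT.

Lemma coker_proj_eq x y : coker_proj x = coker_proj y <-> exists a, f a = x - y.
Proof.
have -> : (exists a, f a = x - y) <-> x - y \in im_pred.
  by split=> /asboolP.
by rewrite Quotient.idealrBE; split=> [/eqP|/eqP].
Qed.

Lemma coker_projD x y : coker_proj (x + y) = coker_proj x + coker_proj y.
Proof. by rewrite /coker_proj !piE. Qed.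

Lemma coker_proj_surj : surj coker_proj.
Proof. by move=> y; exists (repr y); rewrite /coker_proj reprK. Qed.

(** The quotient is formed as an additive group, and scalars act on it through chosen
    representatives; [coker_scaleE] is the independence of the choice. *)
Definition coker_scale (a : R) (y : coker_type) : coker_type :=
  coker_proj (a *: repr (y : @Quotient.quot M im_pred)).

Lemma coker_scaleE a x : coker_scale a (coker_proj x) = coker_proj (a *: x).
Proof.
apply/coker_proj_eq; set z := repr _.
have /coker_proj_eq[b fb] : coker_proj z = coker_proj x by rewrite /coker_proj
  reprK.
by exists (a *: b); rewrite linearZ /= fb scalerBr.
Qed.

Fact coker_scalerA a b v :
  coker_scale a (coker_scale b v) = coker_scale (a * b) v.
Proof. by have [x <-] := coker_proj_surj v; rewrite !coker_scaleE scalerA. Qed.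

Fact coker_scale1r : left_id 1 coker_scale.
Proof. by move=> v; have [x <-] := coker_proj_surj v;
  rewrite coker_scaleE scale1r. Qed.

Fact coker_scalerDr : right_distributive coker_scale +%R.
Proof.
move=> a u v; have [x <-] := coker_proj_surj u;
  have [y <-] := coker_proj_surj v.
by rewrite -coker_projD !coker_scaleE scalerDr coker_projD.
Qed.

Fact coker_scalerDl v : {morph coker_scale^~ v : a b / a + b}.
Proof.
move=> a b; have [x <-] := coker_proj_surj v.
by rewrite !coker_scaleE scalerDl coker_projD.
Qed.

HB.instance Definition _ := GRing.Zmodule_isLmodule.Build R coker_type
  coker_scalerA coker_scale1r coker_scalerDr coker_scalerDl.

Fact coker_proj_linear : linear coker_proj.
Proof. by move=> a x y; rewrite coker_projD -coker_scaleE. Qed.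

End Cokernel.

Lemma cokernel_exists_lmod A M (f : {linear A -> M}) :
  exists (Q : lmodType R) (p : {linear M -> Q}),
    surj p /\ forall x, p x = 0 <-> exists a, f a = x.
Proof.
have [p pE] := linear_of_fun (@coker_proj_linear _ _ f).
exists (coker_type f : lmodType R), p; split=> [y|x].
  by have [x <-] := coker_proj_surj y; exists x; rewrite pE.
by rewrite -(linear0 p) !pE coker_proj_eq subr0.
Qed.

End LinearMaps.

(** * Bases of subspaces of row spaces *)

(** A free family of rows in [S] has at most [k] members. One of maximal length spans [S], since a
    vector of [S] outside its span could be appended. *)
Lemma subspace_basis (K : fieldType) (k : nat) (S : 'rV[K]_k -> Prop) :
  S 0 -> (forall a u v, S u -> S v -> S (a *: u + v)) ->
  exists (r : nat) (A : 'M[K]_(r, k)),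
    row_free A /\ forall v, S v <-> (v <= A)%MS.
Proof.
move=> S0 Slin.
pose P r := `[< exists A : 'M[K]_(r, k), row_free A /\ forall i, S (row i A) >].
have exP : exists r, P r.
  by exists 0; apply/asboolP; exists 0; split; [rewrite /row_free mxrank0|case].
have leP r : P r -> (r <= k)%N.
  by move=> /asboolP[A [/eqP rA _]]; rewrite -rA rank_leq_col.
case: (ex_maxnP exP leP) => r /asboolP[A [freeA SA]] maxr.
exists r, A; split=> // v; split=> [Sv|/submxP[c ->]].
  apply: contraT => vA.
  have := maxr r.+1; rewrite ltnn => -> //; rewrite -[r.+1]addn1.
  apply/asboolP; exists (col_mx A v); split.
    rewrite /row_free eqn_leq rank_leq_row /= -addsmxE addn1.
    rewrite -{1}(eqP freeA : \rank A = r) rank_ltmx // /ltmx addsmxSl.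
    by apply: contra vA; apply: submx_trans; apply: addsmxSr.
  move=> i; case: (splitP i) => j ij.
    have -> : i = lshift 1 j by apply: val_inj.
    by rewrite rowKu.
  have -> : i = rshift r j by apply: val_inj.
  by rewrite rowKd row_id.
rewrite mulmx_sum_row; elim/big_rec: _ => [//|i x _]; exact: Slin.
Qed.

(** * Modules over a finite dimensional algebra *)

(* [R] is a finite dimensional [K]-algebra through the central map [iota]. This
   avoids an algebra structure on [Lambda^c]. *)
Section FiniteDimension.
Variables (K : fieldType) (R : nzRingType) (iota : {rmorphism K -> R}).
Implicit Types M N : lmodType R.

Definition comb M d (v : 'I_d -> M) (c : 'rV[K]_d) : M :=
  \sum_(i < d) iota (c 0 i) *: v i.

Definition spans M d (v : 'I_d -> M) := forall x, exists c, x = comb v c.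

Lemma combP M d (v : 'I_d -> M) a c e :
  comb v (a *: c + e) = iota a *: comb v c + comb v e.
Proof.
rewrite /comb scaler_sumr -big_split /=; apply: eq_bigr => i _.
by rewrite !mxE rmorphD rmorphM scalerDl scalerA.
Qed.

Lemma comb0 M d (v : 'I_d -> M) : comb v 0 = 0.
Proof. by rewrite /comb big1 // => i _; rewrite mxE rmorph0 scale0r. Qed.

Lemma comb_mulmx M d r (v : 'I_d -> M) (c : 'rV_r) (A : 'M_(r, d)) :
  comb v (c *m A) = comb (fun j => comb v (row j A)) c.
Proof.
rewrite mulmx_sum_row {2}/comb.
elim/big_rec2: _ => [|i x y _ <-]; first exact: comb0.
exact: combP.
Qed.

Lemma comb_linear M N (f : {linear M -> N}) d (v : 'I_d -> M) c :
  f (comb v c) = comb (f \o v) c.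
Proof. by rewrite /comb linear_sum; apply: eq_bigr => i _; rewrite linearZ. Qed.

Definition spanned d M := exists v : 'I_d -> M, spans v.

Lemma spanned_surj M N (f : {linear M -> N}) d :
  surj f -> spanned d M -> spanned d N.
Proof.
move=> sf [v vM]; exists (f \o v) => y; have [x <-] := sf y.
by have [c ->] := vM x; exists c; rewrite comb_linear.
Qed.

Lemma spanned_surj_lt M N (f : {linear M -> N}) d :
  surj f -> ~ injective f -> spanned d M -> exists2 d', (d' < d)%N & spanned d'
    N.
Proof.
move=> sf ninj [v vM].
have [c [i ci fc0]] : exists c :
  'rV_d, exists2 i, c 0 i != 0 & comb (f \o v) c = 0.
  apply: contrapT => H; apply: ninj; apply: lin_inj => x fx0.
  have [c xE] := vM x; have [c0|nc0] := eqVneq c 0;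
    first by rewrite xE c0 comb0.
  case: H; have /existsP[i ci] : [exists i, c 0 i != 0].
    apply: contraR nc0; rewrite negb_exists => /forallP H.
    by apply/eqP/rowP => i; rewrite mxE; apply/eqP; rewrite -[_ == _]negbK H.
  by exists c, i => //; rewrite -comb_linear -xE.
case: d v vM c i ci fc0 => [|d] v vM c i ci fc0; first by case: i ci.
exists d => //; exists (fun j => f (v (lift i j))) => y.
have [x <-] := sf y; have [e ->] := vM x; rewrite comb_linear.
(* With this [t], adding [t *: c] cancels the [i]-th coefficient of [e]; as [c] is a relation, the
   combination does not change. *)
pose t := - (e 0 i / c 0 i).
exists (\row_j (t *: c + e) 0 (lift i j)).
have -> : comb (f \o v) e = comb (f \o v) (t *: c + e).
  by rewrite combP fc0 scaler0 add0r.
rewrite /comb (bigD1_ord i) //= !mxE /t mulNr divfK // addNr rmorph0 scale0r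
  add0r.
by apply: eq_bigr => j _; rewrite !mxE.
Qed.

(** The coordinate vectors whose combination lies in the image of [f] form a subspace of [K^d]; a
    basis of it gives a spanning family of [N], and if it has [d] members, the subspace is
    everything. *)
Lemma spanned_inj M N (f : {linear N -> M}) d :
  injective f -> spanned d M ->
  exists2 d', (d' <= d)%N & spanned d' N /\ (d' = d -> surj f).
Proof.
move=> injf [v vM]; pose S c := exists a, f a = comb v c.
have [||r [A [freeA SA]]] := @subspace_basis K d S.
- by exists 0; rewrite comb0 linear0.
- move=> a c e [x xE] [y yE]; exists (iota a *: x + y).
  by rewrite linearP xE yE combP.
exists r; first by rewrite -(eqP freeA : \rank A = r) rank_leq_col.
split.
  have /choice[w wE] : forall j, exists a, f a = comb v (row j A).
    by move=> j; apply/SA; apply: row_sub.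
  exists w => x; have [c cE] := vM (f x).
  have /submxP[e eE] : (c <= A)%MS by apply/SA; exists x.
  exists e; apply: injf; rewrite cE eE comb_mulmx comb_linear.
  by apply: eq_bigr => j _; rewrite /= wE.
move=> rd y; have [c ->] := vM y; apply/SA/submx_full.
by rewrite /row_full (eqP freeA : \rank A = r) rd.
Qed.

Hypothesis iota_central : forall k r, iota k * r = r * iota k.
Hypothesis finR : exists n (b : 'I_n -> R),
  forall r, exists c : 'I_n -> K, r = \sum_(i < n) iota (c i) * b i.

(** As [M] is a [K]-space only through [iota], [phi] is a plain function and its [K]-linearity a
    hypothesis. *)
Lemma comb_delta M d (phi : 'rV[K]_d -> M) :
  (forall a c e, phi (a *: c + e) = iota a *: phi c + phi e) ->
  forall c, phi c = comb (fun i => phi (delta_mx 0 i)) c.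
Proof.
move=> phiP; have phi0 : phi 0 = 0.
  by have := phiP (-1) 0 0; rewrite scaler0 addr0 rmorphN1 scaleN1r addNr.
move=> c; rewrite {1}[c]row_sum_delta /comb.
elim/big_rec2: _ => [|i x y _ <-]; first exact: phi0.
exact: phiP.
Qed.

Lemma spanned_of_fun M d (phi : 'rV[K]_d -> M) :
  (forall a c e, phi (a *: c + e) = iota a *: phi c + phi e) ->
  surj phi -> spanned d M.
Proof.
move=> phiP sphi; exists (fun i => phi (delta_mx 0 i)) => x.
by have [c <-] := sphi x; exists c; apply: comb_delta.
Qed.

(** Given generators [v i] over [R], the [n * m] products [b j *: v i] span over [K]. *)
Lemma fin_genP M : fin_gen M <-> exists d, spanned d M.
Proof.
split=> [[n [v vM]]|[d [v vM]]]; last first.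
  exists d, v => x; have [c ->] := vM x.
  by exists (fun i => iota (c 0 i)).
have [m [b bR]] := finR; exists (n * m)%N.
pose psi (C : 'M[K]_(n, m)) := \sum_i (\sum_j iota (C i j) * b j) *: v i.
apply: (@spanned_of_fun _ _ (psi \o vec_mx)) => [a c e|x] /=.
  rewrite linearP /psi scaler_sumr -big_split /=; apply: eq_bigr => i _.
  rewrite scalerA -scalerDl; congr (_ *: _).
  rewrite mulr_sumr -big_split /=; apply: eq_bigr => j _.
  by rewrite !mxE rmorphD rmorphM mulrDl mulrA.
have [c ->] := vM x; have /choice[e eE] := fun i => bR (c i).
exists (mxvec (\matrix_(i, j) e i j)); rewrite mxvecK.
apply: eq_bigr => i _; rewrite eE; congr (_ *: _).
by apply: eq_bigr => j _; rewrite mxE.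
Qed.

Lemma fin_gen_surj M N (f : {linear M -> N}) : surj f -> fin_gen M -> fin_gen N.
Proof.
move=> sf /fin_genP[d Md]; apply/fin_genP; exists d.
exact: spanned_surj sf Md.
Qed.

Lemma fin_gen_inj M N (f : {linear N -> M}) :
  injective f -> fin_gen M -> fin_gen N.
Proof.
move=> injf /fin_genP[d Md]; apply/fin_genP.
by have [e _ [Ne _]] := spanned_inj injf Md; exists e.
Qed.

Lemma fin_gen_prod M N : fin_gen M -> fin_gen N -> fin_gen (M * N)%type.
Proof.
move=> /fin_genP[d [v vM]] /fin_genP[e [w wN]]; apply/fin_genP.
exists (d + e)%N.
pose phi (c : 'rV[K]_(d + e)) := (comb v (lsubmx c), comb w (rsubmx c)).
apply: (@spanned_of_fun (M * N)%type _ phi) => [a c c'|[x y]].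
  by rewrite /phi !linearP /= !combP.
have [c ->] := vM x; have [c' ->] := wN y; exists (row_mx c c').
by rewrite /phi row_mxKl row_mxKr.
Qed.

Lemma fin_gen_rV0 : fin_gen ('rV[R]_0 : lmodType R).
Proof. by exists 0, (fun=> 0) => x; exists (fun=> 0); apply/rowP; case. Qed.

Lemma fin_gen_regular : fin_gen (R^o : lmodType R).
Proof. by exists 1, (fun=> 1) => x; exists (fun=> x);
  rewrite big_ord1 /GRing.scale /= mulr1. Qed.

(** A linear map is determined by the matrix of coordinates of the images of the [v i]. The matrices
    that describe linear maps form a subspace, and a basis of it gives the [h i]. *)
Lemma hom_basis M N : fin_gen M -> fin_gen N ->
  exists n (h : 'I_n -> {linear M -> N}),
    forall f : {linear M -> N}, exists c : 'I_n -> K,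
      forall x, f x = \sum_(i < n) iota (c i) *: h i x.
Proof.
move=> /fin_genP[d [v vM]] /fin_genP[e [w wN]].
pose S (u : 'rV[K]_(d * e)) := exists f : {linear M -> N},
  forall i, f (v i) = comb w (row i (vec_mx u)).
have [||r [A [_ SA]]] := @subspace_basis K _ S.
- by exists \0 => i; rewrite !linear0 comb0.
- move=> a u1 u2 [f1 f1E] [f2 f2E].
  (* Centrality of [iota] makes a [K]-multiple of an [R]-linear map [R]-linear. *)
  have lf : linear (fun x => iota a *: f1 x + f2 x).
    by move=> k x y; rewrite !linearP !scalerDr !scalerA iota_central addrACA.
  have [f fE] := linear_of_fun lf; exists f => i.
  by rewrite fE f1E f2E !linearP /= combP.
have /choice[h hE] : forall j, S (row j A) by move=> j; apply/SA;
  apply: row_sub.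
exists r, h => f; have /choice[C CE] := fun i => wN (f (v i)).
have /submxP[c cE] : (mxvec (\matrix_i C i) <= A)%MS.
  by apply/SA; exists f => i; rewrite mxvecK rowK.
exists (c 0) => x; have [q ->] := vM x.
rewrite comb_linear /comb.
under [RHS]eq_bigr do rewrite (comb_linear (h _)) /comb scaler_sumr.
rewrite exchange_big /=; apply: eq_bigr => i _.
under eq_bigr do rewrite scalerA iota_central -scalerA hE.
rewrite -scaler_sumr; congr (_ *: _).
pose phi u := comb w (row i (vec_mx u)).
have -> : f (v i) = phi (c *m A) by rewrite /phi -cE mxvecK rowK.
have phiP a u u' : phi (a *: u + u') = iota a *: phi u + phi u'.
  by rewrite /phi !linearP /= combP.
rewrite mulmx_sum_row; elim/big_rec2: _ => [|j y z _ <-].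
  by rewrite /phi !linear0 comb0.
exact: phiP.
Qed.

Fact dim_subproof (M : fgmod R) : exists d, `[< spanned d M >].
Proof. by have /fin_genP[d Md] := fgmod_fin_gen M; exists d; apply/asboolP. Qed.

(** This is the [K]-dimension; as a least size, it is bounded above by exhibiting a spanning
    family. *)
Definition fg_dim (M : fgmod R) : nat := ex_minn (dim_subproof M).

Lemma dim_spanned (M : fgmod R) : spanned (fg_dim M) M.
Proof. by rewrite /fg_dim; case: ex_minnP => d /asboolP. Qed.

Lemma dim_min (M : fgmod R) d : spanned d M -> (fg_dim M <= d)%N.
Proof. by rewrite /fg_dim; case: ex_minnP => e _ H Md; apply/H/asboolP. Qed.

Lemma dim_surj (M N : fgmod R) (f : {linear M -> N}) :
  surj f -> (fg_dim N <= fg_dim M)%N.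
Proof. by move=> sf; apply: dim_min;
  apply: spanned_surj sf (dim_spanned M). Qed.

Lemma dim_inj (M N : fgmod R) (f : {linear N -> M}) :
  injective f -> (fg_dim N <= fg_dim M)%N.
Proof.
move=> injf; have [d led [Nd _]] := spanned_inj injf (dim_spanned M).
exact: leq_trans (dim_min Nd) led.
Qed.

Lemma surj_dim_inj (M N : fgmod R) (f : {linear M -> N}) :
  surj f -> (fg_dim M <= fg_dim N)%N -> injective f.
Proof.
move=> sf le; apply: contrapT => ninj.
have [d ltd Nd] := spanned_surj_lt sf ninj (dim_spanned M).
by have := leq_trans ltd le; rewrite ltnNge dim_min.
Qed.

Lemma inj_dim_surj (M N : fgmod R) (f : {linear N -> M}) :
  injective f -> (fg_dim M <= fg_dim N)%N -> surj f.
Proof.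
move=> injf le; have [d led [Nd]] := spanned_inj injf (dim_spanned M).
by apply; apply/eqP; rewrite eqn_leq led (leq_trans le) ?dim_min.
Qed.

End FiniteDimension.

(** * Retracts and direct sums *)

Section Retracts.
Variable R : nzRingType.
Implicit Types A B M N X Y : lmodType R.

Lemma isom_sym M N : isom M N -> isom N M.
Proof.
case=> f /linear_inverse[g [fK gK]].
by exists g; exists f.
Qed.

Lemma isom_trans M N X : isom M N -> isom N X -> isom M X.
Proof. by case=> f bf [g bg]; exists (g \o f); apply: bij_comp. Qed.

Lemma isom_refl M : isom M M.
Proof. by exists idfun; exists idfun. Qed.

(** A pair of splitting maps composes more easily than an isomorphism with a chosen complement;
    [retract_summand] identifies the two notions. *)
Definition retract A B :=
  exists (u : {linear A -> B}) (v : {linear B -> A}), forall x, v (u x) = x.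

Lemma retract_trans A B X : retract A B -> retract B X -> retract A X.
Proof.
case=> u [v vu] [u' [v' vu']]; exists (u' \o u), (v \o v') => x /=.
by rewrite vu' vu.
Qed.

Lemma isom_retract M N : isom M N -> retract M N.
Proof. by case=> f /linear_inverse[g [fK _]]; exists f, g. Qed.

Lemma retract_refl M : retract M M.
Proof. exact/isom_retract/isom_refl. Qed.

Lemma retract_fst A B : retract A (A * B)%type.
Proof. by exists (@split_inl R A B), fst. Qed.

Lemma prod_swap A B : isom (A * B)%type (B * A)%type.
Proof.
have [h hE] := @linear_pair R (A * B)%type B A snd fst.
have [g gE] := @linear_pair R (B * A)%type A B snd fst.
by exists h; exists g => -[x y]; rewrite ?hE ?gE ?hE.
Qed.

Lemma prod_assoc A B X : isom (A * (B * X))%type (A * B * X)%type.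
Proof.
have lh : linear (fun z => (z.1, z.2.1, z.2.2) : (A * B * X)%type).
  by move=> k [x [y z]] [x' [y' z']].
have [h hE] := @linear_of_fun R (A * (B * X))%type (A * B * X)%type _ lh.
exists h; exists (fun z => (z.1.1, (z.1.2, z.2))) => [[x [y z]]|[[x y] z]];
  by rewrite hE.
Qed.

Lemma isom_prod A B X Y : isom A X -> isom B Y -> isom (A * B)%type (X *
  Y)%type.
Proof.
case=> f [f' fK f'K] [g [g' gK g'K]].
have [h hE] := @linear_pair R (A * B)%type X Y (f \o fst) (g \o snd).
exists h; exists (fun z => (f' z.1, g' z.2)) => -[x y]; rewrite hE /=.
  by rewrite fK gK.
by rewrite f'K g'K.
Qed.

Lemma retract_snd A B : retract B (A * B)%type.
Proof. exact: retract_trans (retract_fst B A) (isom_retract (prod_swap B A)).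
  Qed.

Lemma retract_prod A B X Y :
  retract A X -> retract B Y -> retract (A * B)%type (X * Y)%type.
Proof.
case=> u [v vu] [u' [v' vu']].
have [h hE] := @linear_pair R (A * B)%type X Y (u \o fst) (u' \o snd).
have [g gE] := @linear_pair R (X * Y)%type A B (v \o fst) (v' \o snd).
by exists h, g => -[x y]; rewrite hE gE /= vu vu'.
Qed.

(* The complement is the kernel of the retraction. *)
Lemma retract_summand A B : retract A B <-> direct_summand A B.
Proof.
split=> [[u [v vu]]|[A' AB]]; last first.
  exact: retract_trans (retract_fst A A') (isom_retract AB).
have [L [i [inji kerv]]] := kernel_exists_lmod v.
have vi z : v (i z) = 0 by apply/kerv; exists z.
exists L; have [h hE] := linear_copair u i; exists h; apply: bij_inj_surj.
  apply: lin_inj => -[x z]; rewrite hE => uiz.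
  have x0 : x = 0 by rewrite -[LHS]vu -[v _]addr0 -(vi z) -linearD uiz linear0.
  move: uiz; rewrite x0 linear0 add0r => iz0.
  by congr pair; apply: inji; rewrite iz0 linear0.
move=> y; have /kerv[z zE] : v (y - u (v y)) = 0 by rewrite linearB vu subrr.
by exists (v y, z); rewrite hE zE addrC subrK.
Qed.

Lemma rV0_eq0 (x : 'rV[R]_0) : x = 0.
Proof. by apply/rowP; case. Qed.

Lemma isom_prod_rV0 A : isom ('rV[R]_0 * A)%type A.
Proof.
exists snd; exists (fun x => (0, x)) => // -[x y] /=.
by rewrite [x]rV0_eq0.
Qed.

(** [add P] is the case where [Phi] means being a direct summand of [P]; decompositions into
    indecomposables are another case. *)
Definition sum_of (Phi : lmodType R -> Prop) M :=
  exists (n : nat) (F : nat -> lmodType R),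
    (forall i, (i < n)%N -> Phi (F i)) /\ isom (dsum n F) M.

Lemma sum_of_isom Phi M N : isom M N -> sum_of Phi M -> sum_of Phi N.
Proof.
by move=> MN [n [F [FP FM]]]; exists n, F; split=> //; apply: isom_trans MN.
Qed.

Lemma dsum_ext n (F G : nat -> lmodType R) :
  (forall i, (i < n)%N -> F i = G i) -> dsum n F = dsum n G.
Proof.
elim: n => //= n IH FG; rewrite FG // IH // => i ltin.
exact/FG/ltnW.
Qed.

Lemma sum_of0 Phi M : (forall x : M, x = 0) -> sum_of Phi M.
Proof.
move=> M0; exists 0, (fun=> M); split=> //.
by exists \0; exists (fun=> 0) => x; rewrite ?[x]rV0_eq0 ?[x]M0.
Qed.

Lemma sum_of1 (Phi : lmodType R -> Prop) M : Phi M -> sum_of Phi M.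
Proof. by exists 1, (fun=> M); split=> //; apply: isom_prod_rV0. Qed.

Lemma sum_of_prod Phi M N : sum_of Phi M -> sum_of Phi N -> sum_of Phi (M *
  N)%type.
Proof.
case=> n [F [FP FM]] [m [G [GP GN]]].
suff {M N FM GN} H : sum_of Phi (dsum n F * dsum m G)%type.
  exact: sum_of_isom (isom_prod FM GN) H.
elim: m G GP => [|m IH] G GP /=.
  apply: (@sum_of_isom _ (dsum n F)); last by exists n, F; split=> //;
    apply: isom_refl.
  apply: isom_sym; apply: isom_trans (prod_swap _ _) _.
  exact: isom_prod_rV0.
have [k [H [HP Hk]]] := IH G (fun i ltim => GP i (ltnW ltim)).
exists k.+1, (fun i => if i == k then G m else H i); split=> [i|].
  rewrite ltnS leq_eqVlt; case: eqP => [_ _|_ /= ltik]; [exact: GP|exact: HP].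
apply: isom_trans (isom_sym (prod_assoc _ _ _)).
rewrite /= eqxx; apply: isom_prod; last exact: isom_refl.
apply: isom_trans Hk; rewrite (@dsum_ext k _ H); first exact: isom_refl.
by move=> i; case: eqP => // ->; rewrite ltnn.
Qed.

Lemma retract_dsum n (F : nat -> lmodType R) A :
  (forall i, (i < n)%N -> retract (F i) A) ->
  retract (dsum n F) (dsum n (fun=> A)).
Proof.
elim: n => [|n IH] FA /=; first exact: retract_refl.
apply: retract_prod; last exact: FA.
by apply: IH => i ltin; apply/FA/ltnW.
Qed.

Lemma retract_component n (F : nat -> lmodType R) i :
  (i < n)%N -> retract (F i) (dsum n F).
Proof.
elim: n => // n IH; rewrite ltnS leq_eqVlt => /predU1P[->|/IH Fi].
  exact: retract_snd.
exact: retract_trans Fi (retract_fst _ _).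
Qed.

Lemma linear_prod_split A B X (f : {linear (A * B)%type -> X}) :
  exists (f1 : {linear A -> X}) (f2 : {linear B -> X}),
    forall z, f z = f1 z.1 + f2 z.2.
Proof.
have [inr inrE] := @linear_pair R B A B \0 idfun.
exists (f \o @split_inl R A B), (f \o inr) => -[x y] /=.
by rewrite inrE -linearD /split_inl; congr (f _); congr pair;
  rewrite /= ?addr0 ?add0r.
Qed.

Lemma dsum_lift n A B N (r : {linear B -> N}) :
  (forall f : {linear A -> N}, exists g :
    {linear A -> B}, forall x, r (g x) = f x) ->
  forall f : {linear dsum n (fun=> A) -> N},
    exists g : {linear dsum n (fun=> A) -> B}, forall x, r (g x) = f x.
Proof.
move=> lift1; elim: n => [|n IH] /= f.
  by exists \0 => x; rewrite [x]rV0_eq0 !linear0.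
have [f1 [f2 fE]] := linear_prod_split f.
have [g1 g1E] := IH f1; have [g2 g2E] := lift1 f2.
exists ((g1 \o fst) \+ (g2 \o snd)) => x /=.
by rewrite fE linearD g1E g2E.
Qed.

Lemma dsum_colift n A B N (g : {linear B -> N}) :
  (forall f : {linear B -> A}, exists h :
    {linear N -> A}, forall x, h (g x) = f x) ->
  forall f : {linear B -> dsum n (fun=> A)},
    exists h : {linear N -> dsum n (fun=> A)}, forall x, h (g x) = f x.
Proof.
move=> lift1; elim: n => [|n IH] /= f.
  by exists \0 => x; rewrite [f x]rV0_eq0.
have [h1 h1E] := IH (fst \o f); have [h2 h2E] := lift1 (snd \o f).
have [h hE] := linear_pair h1 h2; exists h => x.
by rewrite hE h1E h2E /=; case: (f x).
Qed.

(** The map [u] constructed here is [g] applied in each component. *)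
Lemma dsum_extend n A B N (g : {linear A -> B}) :
  (forall f : {linear A -> N}, exists h :
    {linear B -> N}, forall x, h (g x) = f x) ->
  forall f : {linear dsum n (fun=> A) -> N},
  exists (u : {linear dsum n (fun=> A) -> dsum n (fun=> B)})
         (h : {linear dsum n (fun=> B) -> N}), forall x, h (u x) = f x.
Proof.
move=> ext1; elim: n => [|n IH] /= f.
  by exists idfun, f.
have [f1 [f2 fE]] := linear_prod_split f.
have [u1 [h1 hE1]] := IH f1; have [h2 hE2] := ext1 f2.
have [u uE] := linear_pair (u1 \o fst) (g \o snd).
exists u, ((h1 \o fst) \+ (h2 \o snd)) => x.
by rewrite uE /= hE1 hE2 fE.
Qed.

(** [r] has the components [h i], and [s i] is the inclusion of the [i]-th copy of [M]. *)
Lemma collect_sources M N n (h : nat -> {linear M -> N}) :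
  exists (r : {linear dsum n (fun=> M) -> N}) (s :
    nat -> {linear M -> dsum n (fun=> M)}),
    forall i, (i < n)%N -> forall x, r (s i x) = h i x.
Proof.
elim: n => [|n [r [s rs]]] /=; first by exists \0, (fun=> \0).
have [inr inrE] := @linear_pair R M (dsum n (fun=> M)) M \0 idfun.
exists ((r \o fst) \+ (h n \o snd)).
exists (fun i => if i == n then inr else @split_inl R _ M \o s i) => i.
rewrite ltnS leq_eqVlt; case: eqP => [-> _|_ /= ltin] x /=.
  by rewrite inrE /= linear0 add0r.
by rewrite rs // linear0 addr0.
Qed.

Lemma collect_targets M N n (h : nat -> {linear M -> N}) :
  exists (r : {linear M -> dsum n (fun=> N)}) (s :
    nat -> {linear dsum n (fun=> N) -> N}),
    forall i, (i < n)%N -> forall x, s i (r x) = h i x.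
Proof.
elim: n => [|n [r [s rs]]] /=; first by exists \0, (fun=> \0).
have [r' rE'] := linear_pair r (h n).
pose tgt := {linear dsum n.+1 (fun=> N) -> N}.
exists r', (fun i => if i == n then (snd : tgt) else (s i \o fst : tgt)) => i.
rewrite ltnS leq_eqVlt; case: eqP => [-> _|_ /= ltin] x; rewrite /= rE' //.
by rewrite rs.
Qed.

End Retracts.

(** * Approximations and vanishing of Ext *)

Section FgModules.
Variables (K : fieldType) (R : nzRingType) (iota : {rmorphism K -> R}).
Hypothesis iota_central : forall k r, iota k * r = r * iota k.
Hypothesis finR : exists n (b : 'I_n -> R),
  forall r, exists c : 'I_n -> K, r = \sum_(i < n) iota (c i) * b i.
Implicit Types A B M N P X Y : fgmod R.
Local Notation dim := (fg_dim finR).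

Definition fg_prod A B : fgmod R :=
  FgMod (fin_gen_prod finR (fgmod_fin_gen A) (fgmod_fin_gen B)).

Lemma fin_gen_pow n P : fin_gen (dsum n (fun=> P)).
Proof.
elim: n => [|n IH] /=; first exact: fin_gen_rV0.
exact: (fin_gen_prod finR IH (fgmod_fin_gen P)).
Qed.

Definition pow n P : fgmod R := FgMod (fin_gen_pow n P).

Definition fg_zero : fgmod R := FgMod (fin_gen_rV0 R).

Lemma kernel_exists M N (f : {linear M -> N}) :
  exists (L : fgmod R) (i : {linear L -> M}),
    injective i /\ forall x, f x = 0 <-> exists a, i a = x.
Proof.
have [L [i [inji kerf]]] := kernel_exists_lmod f.
by exists (FgMod (fin_gen_inj finR inji (fgmod_fin_gen M))), i.
Qed.

Lemma cokernel_exists A M (f : {linear A -> M}) :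
  exists (Q : fgmod R) (p : {linear M -> Q}),
    surj p /\ forall x, p x = 0 <-> exists a, f a = x.
Proof.
have [L [p [sp kerp]]] := cokernel_exists_lmod f.
by exists (FgMod (fin_gen_surj finR sp (fgmod_fin_gen M))), p.
Qed.

(** The image is built as the cokernel of the kernel. *)
Lemma image_exists M N (f : {linear M -> N}) :
  exists (I : fgmod R) (e : {linear M -> I}) (j : {linear I -> N}),
    [/\ surj e, injective j & forall x, j (e x) = f x].
Proof.
have [L [i [inji kerf]]] := kernel_exists f.
have [I [e [se kere]]] := cokernel_exists i.
have [j jE] : exists j : {linear I -> N}, forall x, j (e x) = f x.
  by apply: factor_through_surj => // a /kere/kerf.
exists I, e, j; split=> //; apply: lin_inj => x.
by have [y <-] := se x; rewrite jE => /kerf/kere.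
Qed.

Lemma pullback_exists A B X (f : {linear A -> X}) (g : {linear B -> X}) :
  exists (Z : fgmod R) (a : {linear Z -> A}) (b : {linear Z -> B}),
    [/\ forall z, f (a z) = g (b z),
        forall x y, f x = g y -> exists2 z, a z = x & b z = y,
        forall z, a z = 0 -> b z = 0 -> z = 0
      & forall (W : lmodType R) (u : {linear W -> A}) (v : {linear W -> B}),
          (forall w, f (u w) = g (v w)) ->
          exists h : {linear W -> Z}, forall w, a (h w) = u w /\ b (h w) = v w].
Proof.
pose d : {linear fg_prod A B -> X} := (f \o fst) \- (g \o snd).
have [Z [i [inji kerd]]] := kernel_exists d.
exists Z, (fst \o i), (snd \o i); split=> [z|x y fg|z a0 b0|W u v uv] /=.
- have /kerd/eqP : exists z', i z' = i z by exists z.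
  by rewrite subr_eq0 => /eqP.
- have /kerd[z zE] : d (x, y) = 0 by rewrite /d /= fg subrr.
  by exists z; rewrite /= zE.
- by apply: inji; rewrite linear0 [i z]surjective_pairing; congr pair.
- have [w wE] := linear_pair u v.
  have [||h hE] := @factor_through_inj R Z (fg_prod A B) W i w;
    first exact: inji.
    by move=> x; apply/kerd; rewrite wE /d /= uv subrr.
  by exists h => x; rewrite hE wE.
Qed.

(** [Z] is the cokernel of [(f, - g)]. The last clause is exactness at the product: only what comes
    from [X] is identified. *)
Lemma pushout_exists A B X (f : {linear X -> A}) (g : {linear X -> B}) :
  exists (Z : fgmod R) (a : {linear A -> Z}) (b : {linear B -> Z}),
    [/\ forall z, a (f z) = b (g z),
        forall z, exists x y, a x + b y = z
      & forall x y, a x = b y -> exists2 z, f z = x & g z = y].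
Proof.
have [d dE] := @linear_pair R X A B f (\0 \- g).
have [Z [p [sp kerp]]] := @cokernel_exists X (fg_prod A B) d.
have [a [b pE]] := linear_prod_split p.
exists Z, a, b; split=> [z|z|x y axby].
- apply/eqP; rewrite -subr_eq0; apply/eqP.
  have := pE (d z); rewrite dE /= add0r linearN => <-.
  by apply/kerp; exists z; rewrite dE /= add0r.
- by have [[x y] <-] := sp z; exists x, y; rewrite pE.
- have /kerp[z zE] : p (x, - y) = 0 by rewrite pE /= linearN axby subrr.
  move: zE; rewrite dE /= add0r => -[fz /oppr_inj gz]; by exists z.
Qed.

Lemma short_exact_of_surj B X (p : {linear B -> X}) :
  surj p -> exists (L : fgmod R) (i : {linear L -> B}), short_exact i p.
Proof. by move=> sp; have [L [i [inji kerp]]] := kernel_exists p;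
  exists L, i. Qed.

Lemma fin_gen_retract (A : lmodType R) B : retract A B -> fin_gen A.
Proof.
case=> u [v /can_inj inju].
exact: (fin_gen_inj finR inju (fgmod_fin_gen B)).
Qed.

Lemma retract_complement A B :
  retract A B -> exists A' : fgmod R, isom (fg_prod A A') B.
Proof.
case/retract_summand=> A' AB.
have : retract A' B by apply: retract_trans (retract_snd A A') (isom_retract
  AB).
by move=> A'B; exists (FgMod (fin_gen_retract A'B)).
Qed.

(** The components of [r] are a finite [K]-spanning family of the maps from [M] to [N]; a
    combination of them is [r] after the same combination of the inclusions. *)
Lemma hom_approx M N : exists n (r : {linear pow n M -> N}),
  forall f : {linear M -> N}, exists g :
    {linear M -> pow n M}, forall x, r (g x) = f x.
Proof.
have [n [h hE]] := hom_basis iota_central finR (fgmod_fin_gen M) (fgmod_fin_gen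
  N).
(* The family is indexed by [nat] here, and is continued by zero maps from [n] on. *)
have [r [s rs]] := collect_sources n (fun i =>
  odflt (\0 : {linear M -> N}) (omap h (insub i))).
exists n, r => f; have [c cE] := hE f.
have lg : linear (fun x => \sum_(i < n) iota (c i) *: s i x).
  move=> a x y; rewrite scaler_sumr -big_split /=; apply: eq_bigr => i _.
  by rewrite linearP scalerDr !scalerA iota_central.
have [g gE] := linear_of_fun lg; exists g => x.
rewrite gE linear_sum cE; apply: eq_bigr => i _.
by rewrite linearZ /= rs // valK.
Qed.

Lemma hom_coapprox M N : exists n (r : {linear M -> pow n N}),
  forall f : {linear M -> N}, exists g :
    {linear pow n N -> N}, forall x, g (r x) = f x.
Proof.
have [n [h hE]] := hom_basis iota_central finR (fgmod_fin_gen M) (fgmod_fin_gen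
  N).
have [r [s rs]] := collect_targets n (fun i =>
  odflt (\0 : {linear M -> N}) (omap h (insub i))).
exists n, r => f; have [c cE] := hE f.
have lg : linear (fun x => \sum_(i < n) iota (c i) *: s i x).
  move=> a x y; rewrite scaler_sumr -big_split /=; apply: eq_bigr => i _.
  by rewrite linearP scalerDr !scalerA iota_central.
have [g gE] := linear_of_fun lg; exists g => x.
by rewrite gE cE; apply: eq_bigr => i _; rewrite rs // valK.
Qed.

Lemma free_cover M : exists n (p :
  {linear pow n (FgMod (fin_gen_regular R)) -> M}), surj p.
Proof.
have [n [v vM]] := fgmod_fin_gen M.
have lh i : linear (fun a : R^o => a *: odflt 0 (omap v (insub i))).
  by move=> a x y; rewrite scalerDl scalerA.
have [h hE] := choice (fun i => @linear_of_fun R R^o M _ (lh i)).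
have [r [s rs]] := collect_sources n h.
exists n, r => x; have [c ->] := vM x.
exists (\sum_(i < n) s i (c i)); rewrite linear_sum; apply: eq_bigr => i _.
by rewrite rs // hE valK.
Qed.

(** * Split sequences and vanishing of Ext^1 *)

Section Extensions.
Variables A B X : fgmod R.
Variables (i : {linear A -> B}) (p : {linear B -> X}).
Hypothesis ip : short_exact i p.

Lemma section_retraction (s : {linear X -> B}) :
  (forall x, p (s x) = x) -> exists r : {linear B -> A}, forall a, r (i a) = a.
Proof.
case: ip => inji kerp _ ps.
have [||r rE] := @factor_through_inj R A B B i (idfun \- (s \o p)).
- exact: inji.
- by move=> b; apply/kerp; rewrite linearB /= ps subrr.
exists r => a; apply: inji; rewrite rE /=.
have -> : p (i a) = 0 by apply/kerp; exists a.
by rewrite linear0 subr0.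
Qed.

Lemma retraction_section (r : {linear B -> A}) :
  (forall a, r (i a) = a) -> exists s : {linear X -> B}, forall x, p (s x) = x.
Proof.
case: ip => inji kerp surjp ri.
have [||s sE] := @factor_through_surj R B X B p (idfun \- (i \o r)).
- exact: surjp.
- by move=> b /kerp[a <-] /=; rewrite ri subrr.
exists s => x; have [b <-] := surjp x; rewrite sE /= linearB /=.
have -> : p (i (r b)) = 0 by apply/kerp; exists (r b).
by rewrite subr0.
Qed.

Lemma Ext1_zero_section :
  Ext1_zero X A -> exists s : {linear X -> B}, forall x, p (s x) = x.
Proof.
move=> /(_ B i p ip)[phi [bphi phii pphi]].
apply: (@retraction_section (fst \o phi)) => a /=.
by rewrite phii.
Qed.

(** The equivalence with the split extension is [(r, p)]. Through this lemma, vanishing of Ext^1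
    becomes a question of sections or retractions. *)
Lemma retraction_ext_equiv (r : {linear B -> A}) :
  (forall a, r (i a) = a) -> ext_equiv i p (@split_inl R A X) (@snd A X).
Proof.
move=> ri; case: ip => inji kerp surjp.
have [phi phiE] := linear_pair r p; exists phi.
have [s ps] := retraction_section ri.
split=> [|a|b]; rewrite ?phiE //; last first.
  by rewrite ri; congr pair; apply/kerp; exists a.
apply: bij_inj_surj => [|[a x]].
  apply: lin_inj => b; rewrite phiE => -[rb0 /kerp[a ab]].
  by move: rb0; rewrite -ab ri => ->; rewrite linear0.
exists (i (a - r (s x)) + s x); rewrite phiE; congr pair.
  by rewrite [LHS]linearD /= ri subrK.
rewrite [LHS]linearD /= ps -[RHS]add0r; congr (_ + _).
by apply/kerp; exists (a - r (s x)).
Qed.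

End Extensions.

Lemma Ext1_zeroI_section A X :
  (forall (B : fgmod R) (i : {linear A -> B}) (p : {linear B -> X}),
     short_exact i p -> exists s : {linear X -> B}, forall x, p (s x) = x) ->
  Ext1_zero X A.
Proof.
move=> H B i p ip; have [s /(section_retraction ip)[r ri]] := H B i p ip.
exact: (retraction_ext_equiv ip ri).
Qed.

Lemma Ext1_zeroI_retraction A X :
  (forall (B : fgmod R) (i : {linear A -> B}) (p : {linear B -> X}),
     short_exact i p -> exists r : {linear B -> A}, forall a, r (i a) = a) ->
  Ext1_zero X A.
Proof.
move=> H B i p ip; have [r ri] := H B i p ip.
exact: (retraction_ext_equiv ip ri).
Qed.

Lemma short_exact_pullback A B X Y (i : {linear A -> B}) (p : {linear B -> X})
    (f : {linear Y -> X}) :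
  short_exact i p ->
  exists (Z : fgmod R) (k : {linear A -> Z}) (y : {linear Z -> Y}) (b :
    {linear Z -> B}),
    [/\ short_exact k y, forall a, b (k a) = i a & forall z, p (b z) = f (y z)].
Proof.
case=> inji kerp surjp.
have [Z [b [y [Zcomm Zex Zinj Zuni]]]] := pullback_exists p f.
have [|k kE] := Zuni A i \0.
  by move=> a; rewrite linear0; apply/kerp; exists a.
have kexact : short_exact k y.
  split=> [|z|x].
  - by move=> a a' kaa; apply: inji; rewrite -(kE a).1 -(kE a').1 kaa.
  - split=> [yz0|[a <-]]; last exact: (kE a).2.
    have /kerp[a ab] : p (b z) = 0 by rewrite Zcomm yz0 linear0.
    exists a; apply/eqP; rewrite -subr_eq0; apply/eqP/Zinj.
      by rewrite linearB /= (kE a).1 ab subrr.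
    by rewrite linearB /= (kE a).2 yz0 subrr.
  - have [b0 bE] := surjp (f x).
    by have [z _ zE] := Zex b0 x bE; exists z.
by exists Z, k, y, b; split=> // a; rewrite (kE a).1.
Qed.

Lemma short_exact_pushout A B X Y (i : {linear A -> B}) (p : {linear B -> X})
    (f : {linear A -> Y}) :
  short_exact i p ->
  exists (Z : fgmod R) (y : {linear Y -> Z}) (q : {linear Z -> X}) (b :
    {linear B -> Z}),
    [/\ short_exact y q, forall a, b (i a) = y (f a) & forall x, q (b x) = p x].
Proof.
case=> inji kerp surjp.
have [Z [b [y [Zcomm Zgen Zex]]]] := pushout_exists i f.
have pi0 a : p (i a) = 0 by apply/kerp; exists a.
have [q qE] : exists q : {linear Z -> X}, forall x y', q (b x + y y') = p x.
  have [h hE] := linear_copair b y.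
  have [||q qE] := @factor_through_surj R (B * Y)%type Z X h (p \o fst).
  - by move=> z; have [x [y' <-]] := Zgen z; exists (x, y'); rewrite hE.
  - move=> [x y']; rewrite hE /= => /eqP; rewrite addr_eq0 -linearN => /eqP.
    by move=> /Zex[a <- _].
  by exists q => x y'; rewrite -hE qE.
have qb x : q (b x) = p x by rewrite -(qE x 0) linear0 addr0.
have qy y' : q (y y') = 0.
  by rewrite -(linear0 p) -(qE 0 y') linear0 add0r.
exists Z, y, q, b; split=> //; split.
- apply: lin_inj => y' yy0.
  have [|a ia fa] := Zex 0 y'; first by rewrite yy0 linear0.
  by rewrite -fa (_ : a = 0) ?linear0 //; apply: inji; rewrite ia linear0.
- move=> z; split=> [|[y' <-] //]; have [x [y' <-]] := Zgen z.
  rewrite qE => /kerp[a <-]; exists (f a + y').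
  by rewrite linearD Zcomm.
- by move=> x; have [x' <-] := surjp x; exists (b x').
Qed.

(** The obstruction to lifting [f] is the pullback of the sequence along [f], an extension of [Y] by
    [A]; a section of it followed by the map to [B] is a lift. *)
Lemma Ext1_zero_lift A B X Y (i : {linear A -> B}) (p : {linear B -> X})
    (f : {linear Y -> X}) :
  short_exact i p -> Ext1_zero Y A ->
  exists g : {linear Y -> B}, forall y, p (g y) = f y.
Proof.
move=> ip YA; have [Z [k [y [b [ky bk pb]]]]] := short_exact_pullback f ip.
have [s sE] := Ext1_zero_section ky YA.
by exists (b \o s) => x; rewrite /= pb sE.
Qed.

(** Dually, the obstruction is the pushout along [f], an extension of [X] by [Y]. *)
Lemma Ext1_zero_extend A B X Y (i : {linear A -> B}) (p : {linear B -> X})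
    (f : {linear A -> Y}) :
  short_exact i p -> Ext1_zero X Y ->
  exists g : {linear B -> Y}, forall a, g (i a) = f a.
Proof.
move=> ip XY; have [Z [y [q [b [yq bi qb]]]]] := short_exact_pushout f ip.
have [s sE] := Ext1_zero_section yq XY.
have [r rE] := section_retraction yq sE.
by exists (r \o b) => a; rewrite /= bi rE.
Qed.

Lemma Ext1_zero_retract A B M : retract A B -> Ext1_zero B M -> Ext1_zero A M.
Proof.
case=> u [v vu] BM; apply: Ext1_zeroI_section => E i p ip.
have [g gE] := Ext1_zero_lift v ip BM.
by exists (g \o u) => x; rewrite /= gE vu.
Qed.

Lemma Ext1_zero_prod A B M :
  Ext1_zero A M -> Ext1_zero B M -> Ext1_zero (fg_prod A B) M.
Proof.
move=> AM BM; apply: Ext1_zeroI_section => E i p ip.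
have [f1 [f2 fE]] := linear_prod_split (idfun :
  {linear fg_prod A B -> fg_prod A B}).
have [g1 g1E] := Ext1_zero_lift f1 ip AM;
  have [g2 g2E] := Ext1_zero_lift f2 ip BM.
exists ((g1 \o fst) \+ (g2 \o snd)) => x /=.
by rewrite linearD g1E g2E -fE.
Qed.

Lemma Ext1_zero_pow n A M : Ext1_zero A M -> Ext1_zero (pow n A) M.
Proof.
move=> AM; apply: Ext1_zeroI_section => E i p ip.
apply: (@dsum_lift R n A E (pow n A) p _ idfun) => f.
exact: (Ext1_zero_lift f ip AM).
Qed.

Lemma Ext1_zero_isom_r A M N : isom M N -> Ext1_zero A M -> Ext1_zero A N.
Proof.
case=> f /linear_inverse[g [fK gK]] AM;
  apply: Ext1_zeroI_section => E i p [inji kerp surjp].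
apply: (@Ext1_zero_lift M E A A (i \o f) p idfun) => //;
  split=> // [a b /inji/(can_inj fK) //|b].
split=> [/kerp[a <-]|[a <-]]; first by exists (g a); rewrite /= gK.
by apply/kerp; exists (f a).
Qed.

End FgModules.

(** * Torsion classes and their progenerators *)

Section TorsionClasses.
Variables (K : fieldType) (R : nzRingType) (iota : {rmorphism K -> R}).
Hypothesis iota_central : forall k r, iota k * r = r * iota k.
Hypothesis finR : exists n (b : 'I_n -> R),
  forall r, exists c : 'I_n -> K, r = \sum_(i < n) iota (c i) * b i.
Implicit Types (A B L M N P Q X Y : fgmod R) (T C : subcat R).
Local Notation dim := (fg_dim finR).
Local Notation pow := (pow finR).
Local Notation fg_prod := (fg_prod finR).

Lemma short_exact_fst A B :
  exists i : {linear B -> fg_prod A B},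
    short_exact i (fst : {linear fg_prod A B -> A}).
Proof.
have [i iE] := @linear_pair R B A B \0 idfun.
exists i; split=> [x y|[x y]|x].
- by rewrite !iE => -[].
- split=> /= [->|[z]]; first by exists y; rewrite iE.
  by rewrite iE => -[<-].
- by exists (x, 0).
Qed.

Section Absolute.
Variables (T : subcat R) (tT : torsion_class (@full_subcat R) T).

Lemma torsion_isom A B : isom A B -> T A -> T B.
Proof. by case: tT => isoT _ _; apply: isoT. Qed.

Lemma torsion_quot A B (f : {linear A -> B}) : surj f -> T A -> T B.
Proof.
move=> sf; have [L [i ip]] := short_exact_of_surj finR sf.
by case: tT => _ _ /(_ L A B i f)[|_].
Qed.

Lemma torsion_ext A B X (i : {linear A -> B}) (p : {linear B -> X}) :
  short_exact i p -> T A -> T X -> T B.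
Proof. by move=> ip; case: tT => _ _ /(_ A B X i p)[|]. Qed.

Lemma torsion_prod A B : T A -> T B -> T (fg_prod A B).
Proof.
move=> TA TB; have [i ip] := short_exact_fst A B.
exact: (torsion_ext ip).
Qed.

Lemma torsion_retract A B : retract A B -> T B -> T A.
Proof. by case=> u [v vu]; apply: (@torsion_quot _ _ v) => x; exists (u x). Qed.

Lemma torsion_zero A : T A -> T (fg_zero R).
Proof. by apply: (@torsion_quot A (fg_zero R) \0) => x; exists 0;
  rewrite [x]rV0_eq0. Qed.

Lemma torsion_pow n A : T A -> T (pow n A).
Proof.
move=> TA; elim: n => [|n IH].
  by apply: torsion_isom (torsion_zero TA); apply: isom_refl.
by apply: torsion_isom (torsion_prod IH TA); apply: isom_refl.
Qed.

(* The fibre product of [A] and [B] over [X] is an extension of [B] by [L'];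
   it maps onto [L] by [(a, b) |-> b - h a]. *)
Lemma kernel_in_torsion L' A X B L (i : {linear L' -> A}) (p : {linear A -> X})
    (q : {linear B -> X}) (h : {linear A -> B}) (k : {linear L -> B}) :
  short_exact i p -> T L' -> T B -> (forall a, q (h a) = p a) ->
  short_exact k q -> T L.
Proof.
move=> ip TL' TB qh [injk kerq surjq].
have [Z [j [b [a [jb aj pa]]]]] := short_exact_pullback finR q ip.
have TZ : T Z by apply: (torsion_ext jb).
have [||g gE] := @factor_through_inj R L B Z k (b \- (h \o a)).
- exact: injk.
- by move=> z; apply/kerq; rewrite linearB /= qh pa subrr.
have [injj kerb surjb] := jb; have [inji kerp _] := ip.
apply: (@torsion_quot Z L g) TZ => x; have [z zE] := surjb (k x).
have /kerp[l lE] : p (a z) = 0 by rewrite pa zE; apply/kerq; exists x.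
have bj0 : b (j l) = 0 by apply/kerb; exists l.
have a0 : a (z - j l) = 0 by rewrite linearB /= aj lE subrr.
exists (z - j l); apply: injk.
by rewrite gE /= a0 linear0 subr0 linearB /= zE bj0 subr0.
Qed.

End Absolute.

Section Relative.
Variables T C : subcat R.
Hypotheses (tT : torsion_class (@full_subcat R) T) (tC : torsion_class T C).

Lemma rel_sub M : C M -> T M.
Proof. by case: tC => _ subC _; apply: subC. Qed.

Lemma rel_isom A B : isom A B -> C A -> C B.
Proof. by case: tC => isoC _ _; apply: isoC. Qed.

Lemma rel_quot A B X (i : {linear A -> B}) (p : {linear B -> X}) :
  short_exact i p -> T A -> C B -> C X.
Proof.
move=> ip TA CB; have TB := rel_sub CB.
have [_ _ surjp] := ip; have TX : T X by apply: torsion_quot surjp TB.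
by case: tC => _ _ /(_ A B X i p)[|_ quotC]; [split|apply: quotC].
Qed.

Lemma rel_ext A B X (i : {linear A -> B}) (p : {linear B -> X}) :
  short_exact i p -> C A -> C X -> C B.
Proof.
move=> ip CA CX; have TA := rel_sub CA; have TX := rel_sub CX.
have TB : T B by apply: (torsion_ext tT ip).
by case: tC => _ _ /(_ A B X i p)[|extC _]; [split|apply: extC].
Qed.

Lemma rel_prod A B : C A -> C B -> C (fg_prod A B).
Proof.
move=> CA CB; have [i ip] := short_exact_fst A B.
exact: (rel_ext ip).
Qed.

(** The kernel [L] of the retraction is itself a quotient of [B], by means of [1 - u v], so it lies
    in [T] and [A] is a quotient of [B] inside [T]. *)
Lemma rel_retract A B : retract A B -> C B -> C A.
Proof.
case=> u [v vu] CB.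
have surjv : surj v by move=> x; exists (u x).
have [L [i iv]] := short_exact_of_surj finR surjv.
have [inji kerv _] := iv.
have [||r rE] := @factor_through_inj R L B B i (idfun \- (u \o v)).
- exact: inji.
- by move=> y; apply/kerv; rewrite linearB /= vu subrr.
have surjr : surj r.
  move=> x; exists (i x); apply: inji; rewrite rE /=.
  have -> : v (i x) = 0 by apply/kerv; exists x.
  by rewrite linear0 subr0.
exact: (rel_quot iv (torsion_quot tT surjr (rel_sub CB)) CB).
Qed.

Lemma rel_zero A : C A -> C (fg_zero R).
Proof.
apply: rel_retract; exists \0, \0 => x.
by rewrite [x]rV0_eq0.
Qed.

Lemma rel_pow n A : C A -> C (pow n A).
Proof.
move=> CA; elim: n => [|n IH].
  by apply: rel_isom (rel_zero CA); apply: isom_refl.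
by apply: rel_isom (rel_prod IH CA); apply: isom_refl.
Qed.

End Relative.

(** * Generation by powers of a module *)

(** The kernel must lie in [T], which may be larger than the class of [M]. For a single class this
    is the generation clause of an Ext-progenerator, with powers of [P] in place of [add P]. *)
Definition generated_by T P M :=
  exists n (L : fgmod R) (i : {linear L -> pow n P}) (p :
    {linear pow n P -> M}),
    T L /\ short_exact i p.

Definition progenerator T P :=
  [/\ T P, forall M, T M -> Ext1_zero P M & forall M, T M -> generated_by T P
    M].

Lemma direct_summand_refl P : direct_summand P P.
Proof. by apply/retract_summand/retract_refl. Qed.

Lemma add_self P : Defs.add P P.
Proof. exact (@sum_of1 R (fun N : lmodType R =>
  direct_summand N P) P (direct_summand_refl P)). Qed.

Lemma add_pow n P : Defs.add P (pow n P).
Proof.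
exists n, (fun=> P); split; last exact: isom_refl.
by move=> i _; apply: direct_summand_refl.
Qed.

(** A presentation of [M] by a power of [P] lifts through [q]; hence [q] is onto, and
    [kernel_in_torsion] compares its kernel with that of the presentation. *)
Lemma generated_kernel T P M B (q : {linear B -> M}) :
  torsion_class (@full_subcat R) T -> generated_by T P M -> T B ->
  (forall f : {linear P -> M}, exists g :
    {linear P -> B}, forall x, q (g x) = f x) ->
  exists (L : fgmod R) (k : {linear L -> B}), T L /\ short_exact k q.
Proof.
move=> tT [n [L' [i [p [TL' ip]]]]] TB lift1.
have [h hE] := dsum_lift lift1 p.
have surjq : surj q.
  move=> y; have [_ _ surjp] := ip; have [x <-] := surjp y.
  by exists (h x).
have [L [k kq]] := short_exact_of_surj finR surjq.
by exists L, k; split=> //; apply: (kernel_in_torsion tT ip TL' TB hE kq).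
Qed.

(* The progenerator is [Q (+) coker g]. For [r : (Q (+) coker g)^n -> M] with
   kernel [L], a map [P -> L] extends along [g] to [Q -> (Q (+) coker g)^n],
   which a map through [coker g] corrects so that it lands in [L]; hence [L] is
   generated by [Q] and lies in [C]. *)
Lemma progenerator_of_left_approx T C P Q (g : {linear P -> Q}) :
  torsion_class (@full_subcat R) T -> torsion_class T C ->
  T P -> (forall M, T M -> generated_by T P M) ->
  left_approx C g -> (forall M, C M -> Ext1_zero Q M) ->
  exists E, progenerator C E.
Proof.
move=> tT tC TP genP [CQ gapp] projQ.
have [I [e [j [surje injj jeg]]]] := image_exists finR g.
have TI : T I by apply: (torsion_quot tT surje TP).
have [D [c [surjc kerc]]] := cokernel_exists finR j.
have jc : short_exact j c by split.
have CD : C D by apply: (rel_quot tT tC jc TI CQ).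
have cg0 x : c (g x) = 0 by apply/kerc; exists (e x).
have desc Y (f : {linear Q -> Y}) : (forall x, f (g x) = 0) ->
    exists f' : {linear D -> Y}, forall x, f' (c x) = f x.
  move=> fg0; apply: factor_through_surj => // a /kerc[b <-].
  by have [x <-] := surje b; rewrite jeg.
(* Given an extension [W] of [D] by [M], lift [c] to [d : Q -> W]. On the image of [g] it takes
   values in [M], and this map extends to [z] on [Q]; then [d - i z] kills the image of [g] and
   descends to a section. *)
have projD M : C M -> Ext1_zero D M.
  move=> CM; apply: Ext1_zeroI_section => W i p ip;
    have [inji kerp surjp] := ip.
  have [d dE] := Ext1_zero_lift finR c ip (projQ M CM).
  have [||y yE] := @factor_through_inj R M W P i (d \o g).
  - exact: inji.
  - by move=> x; apply/kerp; rewrite /= dE cg0.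
  have [z zE] := gapp M y CM.
  have [|s sE] := desc W (d \- (i \o z)).
    by move=> x /=; rewrite -zE yE subrr.
  exists s => x; have [q <-] := surjc x; rewrite sE linearB /= dE.
  have -> : p (i (z q)) = 0 by apply/kerp; exists (z q).
  by rewrite subr0.
exists (fg_prod Q D); split=> [|M CM|M CM].
- exact: (rel_prod tT tC).
- by apply: Ext1_zero_prod; [apply: projQ|apply: projD].
have [n [r rapp]] := hom_approx iota_central finR (fg_prod Q D) M.
set B := pow n _ in r rapp.
have CB : C B by apply: (rel_pow tT tC); apply: (rel_prod tT tC).
have liftQ (f : {linear Q -> M}) : exists h :
  {linear Q -> B}, forall x, r (h x) = f x.
  have [h hE] := rapp (f \o fst); exists (h \o @split_inl R Q D) => x.
  by rewrite /= hE.
have liftD (f : {linear D -> M}) : exists h :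
  {linear D -> B}, forall x, r (h x) = f x.
  have [u [v vu]] := retract_snd Q D.
  have [h hE] := rapp (f \o v); exists (h \o u) => x.
  by rewrite /= hE /= vu.
have liftP (f : {linear P -> M}) : exists h :
  {linear P -> B}, forall x, r (h x) = f x.
  have [f' f'E] := gapp M f CM; have [h hE] := liftQ f'.
  by exists (h \o g) => x; rewrite /= hE f'E.
have TM := rel_sub tC CM; have TB := rel_sub tC CB.
have [L [k [TL kr]]] := generated_kernel tT (genP M TM) TB liftP.
exists n, L, k, r; split=> //.
have [injk kerr _] := kr.
have extP (f : {linear P -> L}) : exists h :
  {linear Q -> L}, forall x, h (g x) = f x.
  have [mu muE] := gapp B (k \o f) CB.
  have [|nu nuE] := desc M (r \o mu).
    by move=> x; rewrite /= -muE; apply/kerr; exists (f x).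
  have [nu' nu'E] := liftD nu.
  have [||h hE] := @factor_through_inj R L B Q k (mu \- (nu' \o c)).
  - exact: injk.
  - by move=> x; apply/kerr; rewrite linearB /= nu'E nuE subrr.
  by exists h => x; apply: injk; rewrite hE /= cg0 linear0 subr0 -muE.
have [m [L' [i [p [TL' ip]]]]] := genP L TL.
have [u [h hE]] := dsum_extend extP p.
have surjh : surj h.
  by move=> y; have [_ _ surjp] := ip; have [x <-] := surjp y; exists (u x).
have [L'' [k' k'h]] := @short_exact_of_surj _ _ _ finR (pow m Q) L h surjh.
have TQm : T (pow m Q) by apply: (torsion_pow tT); apply: (rel_sub tC).
have TL'' := @kernel_in_torsion _ tT _ _ _ (pow m Q) _ _ _ _ _ _ ip TL' TQm hE
  k'h.
exact: (rel_quot tT tC k'h TL'' (rel_pow tT tC m CQ)).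
Qed.

End TorsionClasses.

(** * Basic progenerators, Krull-Schmidt and minimal approximations *)

Section KrullSchmidt.
Variables (K : fieldType) (R : nzRingType) (iota : {rmorphism K -> R}).
Hypothesis iota_central : forall k r, iota k * r = r * iota k.
Hypothesis finR : exists n (b : 'I_n -> R),
  forall r, exists c : 'I_n -> K, r = \sum_(i < n) iota (c i) * b i.
Implicit Types (A B L M N P Q X Y : fgmod R) (T C : subcat R).
Local Notation dim := (fg_dim finR).
Local Notation pow := (pow finR).
Local Notation fg_prod := (fg_prod finR).
Local Notation progenerator := (progenerator finR).

Lemma ex_min_dim (Phi : fgmod R -> Prop) :
  (exists M, Phi M) -> exists M, Phi M /\ forall N, Phi N -> (dim M <= dim N)%N.
Proof.
case=> M0 PM0; pose p d := `[< exists M, Phi M /\ dim M = d >].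
have exp : exists d, p d by exists (dim M0); apply/asboolP; exists M0.
case: (ex_minnP exp) => d /asboolP[M [PM <-]] minM; exists M; split=> // N PN.
by apply: minM; apply/asboolP; exists N.
Qed.

Lemma ex_max_dim (Phi : fgmod R -> Prop) b :
  (exists M, Phi M) -> (forall M, Phi M -> (dim M <= b)%N) ->
  exists M, Phi M /\ forall N, Phi N -> (dim N <= dim M)%N.
Proof.
case=> M0 PM0 leb; pose p d := `[< exists M, Phi M /\ dim M = d >].
have exp : exists d, p d by exists (dim M0); apply/asboolP; exists M0.
have lep d : p d -> (d <= b)%N by move=> /asboolP[M [PM <-]]; apply: leb.
case: (ex_maxnP exp lep) => d /asboolP[M [PM <-]] maxM; exists M;
  split=> // N PN.
by apply: maxM; apply/asboolP; exists N.
Qed.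

(** The image of [phi] still carries a left approximation, because [phi] fixes [g]; minimality of
    dimension forces it to be all of [Q]. *)
Lemma left_approx_min_iso T P Q (g : {linear P -> Q}) (phi : {linear Q -> Q}) :
  torsion_class (@full_subcat R) T -> left_approx T g ->
  (forall Q' (g' : {linear P -> Q'}), left_approx T g' -> (dim Q <= dim Q')%N)
    ->
  (forall x, phi (g x) = g x) -> bijective phi.
Proof.
move=> tT [TQ gapp] minQ phig.
have [I [e [j [surje injj je]]]] := image_exists finR phi.
have le : (dim Q <= dim I)%N.
  apply: (minQ I (e \o g)); split; first exact: (torsion_quot finR tT surje).
  move=> N f TN; have [h hE] := gapp N f TN.
  by exists (h \o j) => x; rewrite /= je phig hE.
have surjj := inj_dim_surj injj le.
have surjphi : surj phi.
  move=> y; have [x <-] := surjj y; have [z <-] := surje x.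
  by exists z; rewrite je.
exact: (bij_inj_surj (surj_dim_inj (finR := finR) surjphi (leqnn _)) surjphi).
Qed.

Lemma free_lift (B X : fgmod R) (p : {linear B -> X}) (f : {linear R^o -> X}) :
  surj p -> exists g : {linear R^o -> B}, forall a, p (g a) = f a.
Proof.
move=> surjp; have [b bE] := surjp (f 1).
have lg : linear (fun a : R^o => a *: b) by move=> a x y;
  rewrite scalerDl scalerA.
have [g gE] := @linear_of_fun R R^o B _ lg; exists g => a.
rewrite gE linearZ /= bE -linearZ; congr (f _).
exact: mulr1.
Qed.

(** The minimal approximation [g : R -> Q] has [Q] Ext-projective in [T]: for an extension [E] of
    [Q], lift [g] to [E] by freeness and factor the lift through [g] as [h], since [E] lies in [T].
    Then [p h] fixes [g], so it is invertible and [p] splits. *)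
Lemma ff_progenerator T :
  torsion_class (@full_subcat R) T -> functorially_finite T ->
  exists P, progenerator T P.
Proof.
move=> tT ffT; pose P : fgmod R := FgMod (fin_gen_regular R).
pose Phi Q := exists g : {linear P -> Q}, left_approx T g.
have [|Q [[g gapp] minQ]] := @ex_min_dim Phi.
  by have [[N [f fapp]] _] := ffT P; exists N, f.
apply: (@progenerator_of_left_approx _ _ _ iota_central finR (@full_subcat R) T
  P Q g) => //.
  move=> M _; have [n [p surjp]] := free_cover finR M.
  by have [L [i ip]] := short_exact_of_surj finR surjp; exists n, L, i, p.
move=> M TM; apply: Ext1_zeroI_section => E i p ip; have [_ _ surjp] := ip.
have [q qE] := free_lift g surjp.
have [TQ gapp'] := gapp; have TE := torsion_ext tT ip TM TQ.
have [h hE] := gapp' E q TE.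
have [|psi psiK] := @linear_inverse R Q Q (p \o h).
  apply: (left_approx_min_iso tT gapp) => [Q' g' gapp2|x /=].
    by apply: minQ; exists g'.
  by rewrite -hE qE.
by exists (h \o psi) => x; apply: psiK.2.
Qed.

Lemma progenerator_retract T P P' n :
  torsion_class (@full_subcat R) T -> progenerator T P ->
  retract P' P -> retract P (pow n P') -> progenerator T P'.
Proof.
move=> tT [TP projP genP] PP' [u [v vu]].
have TP' := torsion_retract finR tT PP' TP.
split=> // M TM; first exact: (Ext1_zero_retract finR PP' (projP M TM)).
have [m [r rapp]] := hom_approx iota_central finR P' M.
have TB : T (pow m P') by apply: torsion_pow.
have [|L [k [TL kr]]] := @generated_kernel _ _ _ finR T P M (pow m P') r tT
  (genP M TM) TB.
  move=> f; have [h hE] := dsum_lift rapp (f \o v :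
    {linear dsum n (fun=> P') -> M}).
  by exists (h \o u) => x; rewrite /= hE /= vu.
by exists m, L, k, r.
Qed.

(** If [N * N] were a summand of a progenerator of least dimension, dropping one copy of [N] would
    leave a smaller progenerator. *)
Lemma basic_progenerator T :
  torsion_class (@full_subcat R) T -> (exists P, progenerator T P) ->
  exists P, basic P /\ progenerator T P.
Proof.
move=> tT /ex_min_dim[P [progP minP]]; exists P; split=> // N [[x0 /eqP x0n] _].
case=> N' NNP.
have NP : retract N P.
  apply: retract_trans (isom_retract NNP).
  by apply: retract_trans (retract_fst _ _); apply: retract_fst.
have N'P : retract N' P by apply: retract_trans (isom_retract NNP);
  apply: retract_snd.
have fgN := fin_gen_retract finR NP; have fgN' := fin_gen_retract finR N'P.
pose P' := fg_prod (FgMod fgN) (FgMod fgN').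
have NNP' : isom (N * P')%type P by apply: isom_trans (prod_assoc _ _ _) NNP.
have [f bf] := isom_sym NNP'.
have surjf : surj (snd \o f).
  by move=> y; have [x xE] := bij_surj bf (0, y); exists x; rewrite /= xE.
have P'P : retract P' P by apply: retract_trans (isom_retract NNP');
  apply: retract_snd.
have ninj : ~ injective (snd \o f).
  have [y yE] := bij_surj bf (x0, 0); move=> inj; apply: x0n.
  have y0 : y = 0 by apply: inj; rewrite /= yE linear0.
  by move: yE; rewrite y0 linear0 => -[].
apply: ninj; apply: (@surj_dim_inj _ _ _ finR P P' (snd \o f)) surjf _.
(* Two copies of [P'] suffice: [P] is [N * P'], and [N] is a summand of [P']. *)
apply: minP; apply: (@progenerator_retract T P P' 2) => //.
apply: retract_trans (isom_retract (isom_sym NNP')) _.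
apply: retract_prod; last exact: retract_refl.
apply: retract_trans (retract_snd _ _).
exact: (retract_fst N N').
Qed.

Lemma progenerator_ext T P : (forall n, T (pow n P)) ->
  progenerator T P -> ext_progenerator T P.
Proof.
move=> Tpow [TP projP genP]; split=> // M TM.
have [n [L [i [p [TL ip]]]]] := genP M TM.
exists L, (pow n P), i, p; split; first exact: add_pow.
by split.
Qed.


(** * Fitting decomposition and Krull-Schmidt *)

Lemma surj_iter (A : Type) (f : A -> A) n : surj (iter n.+1 f) -> surj f.
Proof. by move=> sf y; have [x <-] := sf y; exists (iter n f x). Qed.

(* Fitting: take the image of an iterate of minimal dimension. *)
Lemma fitting M (g : {linear M -> M}) :
  exists n (I : fgmod R) (e : {linear M -> I}) (j : {linear I -> M}),
    [/\ surj e, injective j, forall x, j (e x) = iter n.+1 g x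
      & exists w : {linear I -> I}, forall x, w (e (j x)) = x].
Proof.
pose Phi (I : fgmod R) := exists n (e : {linear M -> I}) (j : {linear I -> M}),
  [/\ surj e, injective j & forall x, j (e x) = iter n.+1 g x].
have [|I [[n [e [j [surje injj je]]]] minI]] := @ex_min_dim Phi.
  by have [I [e [j ej]]] := image_exists finR g; exists I, 0, e, j.
exists n, I, e, j; split=> //.
have [I' [e' [j' [surje' injj' je']]]] := image_exists finR (e \o j).
have le : (dim I <= dim I')%N.
  (* Running through [j \o e] twice gives the iterate of order twice [n.+1], which is
     [(n.+1 + n).+1]. Its image is not smaller than [I], so [e \o j] is bijective. *)
  apply: minI; exists (n.+1 + n)%N, (e' \o e), (j \o j'); split.
  - move=> y; have [x <-] := surje' y; have [z <-] := surje x; by exists z.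
  - exact: inj_comp.
  - by move=> x; rewrite /= je' /= !je -iterD addnS.
have injej : injective (e \o j).
  move=> x y; rewrite -!je' => /injj';
    apply: (surj_dim_inj (finR := finR)) => //.
have surjej : surj (e \o j) by apply: (inj_dim_surj (finR := finR)).
have [w [wK _]] := linear_inverse (bij_inj_surj injej surjej).
by exists w => x; apply: wK.
Qed.

(** By [fitting], the image of some iterate of [g] is a direct summand, hence zero or everything. *)
Lemma indecomposable_endo M (g : {linear M -> M}) :
  indecomposable M -> bijective g \/ exists n, forall x, iter n g x = 0.
Proof.
move=> [_ indM]; have [n [I [e [j [surje injj je [w wej]]]]]] := fitting g.
have IM : retract I M by exists j, (w \o e).
have [L IL] := retract_complement finR IM.
have nz := indM I L IL.
have zeroP N : ~ nonzero_mod N -> forall x : N, x = 0.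
  by move=> nzN x; apply/eqP; apply: contrapT => /negP x0; apply: nzN; exists x.
have [/zeroP I0|nzI] := EM (~ nonzero_mod I).
  by right; exists n.+1 => x; rewrite -je [e x]I0 linear0.
left; have L0 : forall x : L, x = 0.
  by apply: zeroP => nzL; apply: nz; split=> //; apply: contrapT.
have le : (dim M <= dim I)%N.
  have [f bf] := IL; have [inl inlE] := @linear_pair R I I L idfun \0.
  apply: (dim_surj finR (M := I) (N := M) (f := f \o inl)) => y.
  have [[x z] <-] := bij_surj bf y; exists x; rewrite /= inlE.
  by congr (f _); congr pair; rewrite [z]L0.
have surjg : surj g.
  apply: (@surj_iter _ _ n) => y; have [z zE] := inj_dim_surj (finR := finR)
    injj le y.
  by have [x xE] := surje z; exists x; rewrite -je xE.
exact: (bij_inj_surj (surj_dim_inj (finR := finR) surjg (leqnn _)) surjg).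
Qed.

(** If [a] is nilpotent, then [b x = 0] gives [x = a x], hence [x = 0] by iteration. *)
Lemma indecomposable_local M (a b : {linear M -> M}) :
  indecomposable M -> (forall x, a x + b x = x) -> bijective a \/ bijective b.
Proof.
move=> indM ab; have [|[n an]] := indecomposable_endo a indM; first by left.
right; have injb : injective b.
  apply: lin_inj => x bx0; have ax : a x = x by rewrite -[RHS]ab bx0 addr0.
  by rewrite -(an x); elim: n {an} => //= n <-.
exact: (bij_inj_surj injb (inj_dim_surj (finR := finR) injb (leqnn _))).
Qed.

(** The identity of [M] is the sum of an endomorphism through [A] and one through [B]; one of them
    is invertible. *)
Lemma indecomposable_retract_prod M (A B : lmodType R) :
  indecomposable M -> retract M (A * B)%type -> retract M A \/ retract M B.
Proof.
move=> indM [u [v vu]]; have [v1 [v2 vE]] := linear_prod_split v.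
have [||ba|bb] := @indecomposable_local M (v1 \o (fst \o u)) (v2 \o (snd \o u)).
- exact: indM.
- by move=> x; rewrite -[RHS]vu vE.
- have [w [wK _]] := linear_inverse ba.
  by left; exists (fst \o u), (w \o v1) => x; apply: wK.
- have [w [wK _]] := linear_inverse bb.
  by right; exists (snd \o u), (w \o v2) => x; apply: wK.
Qed.

Lemma indecomposable_retract_dsum M n (F : nat -> lmodType R) :
  indecomposable M -> retract M (dsum n F) ->
  exists2 i, (i < n)%N & retract M (F i).
Proof.
move=> indM; elim: n => [|n IH] /=.
  case: indM => -[x /eqP x0] _ [u [v vu]]; case: x0.
  by rewrite -[x]vu [u x]rV0_eq0 linear0.
case/(indecomposable_retract_prod indM) => [/IH[i ltin Fi]|Fn];
  last by exists n.
by exists i; rewrite // ltnW.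
Qed.

(** Induction on dimension, as both factors of a proper decomposition are smaller. The predicate
    records that each summand is finitely generated, which the family in [dsum] does not. *)
Lemma indecomposable_sum M :
  sum_of (fun N : lmodType R => exists N' :
    fgmod R, N = N' :> lmodType R /\ indecomposable N') M.
Proof.
move: {2}(dim M).+1 (ltnSn (dim M)) => d; elim: d M => // d IH M;
  rewrite ltnS => leMd.
have [M0|nzM] := EM (nonzero_mod M); last first.
  by apply: sum_of0 => x; apply/eqP; apply: contrapT => /negP x0; apply: nzM;
    exists x.
have [indM|] := EM (indecomposable M); first by apply: sum_of1; exists M.
move=> nind; have [A [B [AB [nzA nzB]]]] : exists A B : lmodType R,
    isom (A * B)%type M /\ nonzero_mod A /\ nonzero_mod B.
  apply: contrapT => H; apply: nind; split=> // A B AB [nzA nzB].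
  by apply: H; exists A, B.
have AM : retract A M by apply: retract_trans (isom_retract AB);
  apply: retract_fst.
have BM : retract B M by apply: retract_trans (isom_retract AB);
  apply: retract_snd.
have fgA := fin_gen_retract finR AM; have fgB := fin_gen_retract finR BM.
have lt_dim (X Y : lmodType R) (fgX : fin_gen X) :
    isom (X * Y)%type M -> nonzero_mod Y -> (dim (FgMod fgX) < d)%N.
  move=> XY [y0 /eqP y0n]; apply: leq_trans leMd; rewrite ltnNge;
    apply/negP => le.
  have [f bf] := isom_sym XY; apply: y0n.
  have surjf : surj (fst \o f).
    by move=> x; have [m mE] := bij_surj bf (x, 0); exists m; rewrite /= mE.
  have inj := @surj_dim_inj _ _ _ finR M (FgMod fgX) (fst \o f) surjf le.
  have [m mE] := bij_surj bf (0, y0).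
  have m0 : m = 0 by apply: inj; rewrite /= mE linear0.
  by move: mE; rewrite m0 linear0 => -[].
have BA := isom_trans (prod_swap B A) AB.
apply: (sum_of_isom AB); apply: sum_of_prod.
  exact: (IH (FgMod fgA) (lt_dim A B fgA AB nzB)).
exact: (IH (FgMod fgB) (lt_dim B A fgB BA nzA)).
Qed.

(** Each indecomposable summand of [N] is a summand of a sum of summands of [P], hence of one of
    these. *)
Lemma add_retract P M N : Defs.add P M -> retract N M -> Defs.add P N.
Proof.
case=> n [F [FP FM]] NM; have [m [G [GN GNiso]]] := indecomposable_sum N.
exists m, G; split=> // i /[dup] ltim /GN[N' [GE indN']].
have GiF : retract N' (dsum n F).
  rewrite -GE; apply: retract_trans (isom_retract (isom_sym FM)).
  apply: retract_trans NM; apply: retract_trans (isom_retract GNiso).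
  exact: retract_component.
have [j ltjn NF] := indecomposable_retract_dsum indN' GiF.
apply/retract_summand; rewrite GE; apply: retract_trans NF _.
exact/retract_summand/FP.
Qed.

Lemma add_retract_pow P N : Defs.add P N -> exists n, retract N (pow n P).
Proof.
case=> n [F [FP FN]]; exists n.
apply: retract_trans (isom_retract (isom_sym FN)) _.
by apply: retract_dsum => i /FP/retract_summand.
Qed.

(** An approximation of least dimension is right minimal: if [f g = f], the Fitting image [I] of an
    iterate of [g] is a summand of [N] on which [f] is still an approximation, so [I] is all of
    [N]. *)
Lemma right_minimal_approx P M : exists (N : fgmod R) (f : {linear N -> M}),
  right_approx (Defs.add P) f /\ right_minimal f.
Proof.
pose Phi (N : fgmod R) := exists f :
  {linear N -> M}, right_approx (Defs.add P) f.
have [|N [[f [addN fapp]] minN]] := @ex_min_dim Phi.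
  have [n [r rapp]] := hom_approx iota_central finR P M.
  exists (pow n P), r; split=> [|N h /add_retract_pow[m [u [v vu]]]].
    exact: add_pow.
  have [g gE] := dsum_lift rapp (h \o v : {linear dsum m (fun=> P) -> M}).
  by exists (g \o u) => x; rewrite /= gE /= vu.
exists N, f; split=> // g fg; have [n [I [e [j [surje injj je [w wej]]]]]] :=
  fitting g.
have fiter m x : f (iter m g x) = f x by elim: m => //= m; rewrite fg.
have IN : retract I N by exists j, (w \o e).
have le : (dim N <= dim I)%N.
  apply: minN; exists (f \o j); split=> [|N' h addN'].
    exact: add_retract addN IN.
  have [s sE] := fapp N' h addN'.
  by exists (e \o s) => x; rewrite /= je fiter.
have surjg : surj g.
  apply: (@surj_iter _ _ n) => y; have [z zE] := inj_dim_surj (finR := finR)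
    injj le y.
  by have [x xE] := surje z; exists x; rewrite -je xE.
exact: (bij_inj_surj (surj_dim_inj (finR := finR) surjg (leqnn _)) surjg).
Qed.

End KrullSchmidt.

(** * Twofold torsion classes *)

(** Any torsion class [T] containing [C] contains [T1 C], so a conflation of [T1 C] is one of
    [T]. *)
Lemma twofold_T1 (R : nzRingType) (C : subcat R) :
  twofold_torsion_class C -> torsion_class (T1 C) C.
Proof.
case=> T [tT [isoC subC closC]]; split=> //; first exact: sub_T1.
have sub := T1_min tT subC.
by move=> A B X i p [TA TB TX ip]; apply: (closC A B X i p); split=> //;
  apply: sub.
Qed.

Section TwofoldTorsion.
Variables (K : fieldType) (R : nzRingType) (iota : {rmorphism K -> R}).
Hypothesis iota_central : forall k r, iota k * r = r * iota k.
Hypothesis finR : exists n (b : 'I_n -> R),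
  forall r, exists c : 'I_n -> K, r = \sum_(i < n) iota (c i) * b i.
Implicit Types A B L M N P Q X Y : fgmod R.
Local Notation dim := (fg_dim finR).
Local Notation pow := (pow finR).
Local Notation fg_prod := (fg_prod finR).
Local Notation progenerator := (progenerator finR).
Local Notation generated_by := (generated_by finR).

Variables T C : subcat R.
Hypotheses (tT : torsion_class (@full_subcat R) T) (tC : torsion_class T C).

(** * A generator of [C] from the progenerator of [T] *)

Section Generator.
Variables P : fgmod R.
Hypotheses (progP : progenerator T P) (C_nonempty : exists M, C M).
Hypothesis starP : forall M, C M -> forall N (f : {linear N -> M}),
  right_approx (Defs.add P) f -> right_minimal f -> C N.

(** Take [Q] of maximal dimension. If [N] were not a summand of [Q], it would be one of the
    complement of [Q] in [P], and [Q * N] would be a larger choice. *)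
Lemma largest_summand : exists Q, [/\ retract Q P, C Q &
  forall N, indecomposable N -> C N -> retract N P -> retract N Q].
Proof.
pose Phi Q := retract Q P /\ C Q.
have [||Q [[QP CQ] maxQ]] := @ex_max_dim _ _ _ finR Phi (dim P).
- have [M CM] := C_nonempty; exists (fg_zero R); split;
  last exact: (rel_zero finR tT tC CM).
  by exists \0, \0 => x; rewrite [x]rV0_eq0.
- by move=> M [[u [v /can_inj inju]] _]; apply: (dim_inj finR inju).
exists Q; split=> // N indN CN NP.
have [Q' QQ'] := retract_complement finR QP.
have : retract N (fg_prod Q Q') by apply:
  retract_trans NP (isom_retract (isom_sym QQ')).
case/(indecomposable_retract_prod finR indN) => // NQ'.
have PhiQN : Phi (fg_prod Q N).
  split; last exact: (rel_prod finR tT tC).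
  apply: retract_trans (isom_retract QQ').
  by apply: retract_prod => //; apply: retract_refl.
have surjfst : surj (fst : {linear fg_prod Q N -> Q}) by move=> x;
  exists (x, 0).
have inj := surj_dim_inj (finR := finR) surjfst (maxQ _ PhiQN).
by case: indN => -[x /eqP x0] _; have /(congr1 snd) := inj (0, x) 0 erefl.
Qed.

Lemma add_generator : exists Q,
  [/\ retract Q P, C Q & forall M, C M -> generated_by T Q M].
Proof.
have [Q [QP CQ maxQ]] := largest_summand; exists Q; split=> // M CM.
have [N [f [fapp fmin]]] := right_minimal_approx iota_central finR P M.
have CN := starP CM fapp fmin; have [addN lift] := fapp.
have [n [F [FE FN]]] := indecomposable_sum finR N.
have [m NP] := add_retract_pow finR addN.
(* The indecomposable summands of [N] lie in [C] and are summands of [P], hence of [Q]. *)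
have [u [v vu]] : retract N (pow n Q).
  apply: retract_trans (isom_retract (isom_sym FN)) _.
  apply: retract_dsum => i /[dup] ltin /FE[N' [FiN' indN']].
  have N'N : retract N' N.
    by rewrite -FiN'; apply: retract_trans (isom_retract FN);
      apply: retract_component.
  rewrite FiN'; apply: maxQ => //; first exact: (rel_retract finR tT tC N'N CN).
  by have [_ _] := indecomposable_retract_dsum finR indN' (retract_trans N'N
    NP).
have TQn : T (pow n Q) := torsion_pow finR tT n (rel_sub tC CQ).
have [_ _ genP] := progP.
(* Maps from [P] to [M] lift through [f], and by the splitting [u] also through the power of [Q]; so
   the kernel lies in [T]. *)
have [|L [k [TL kf]]] :=
  @generated_kernel _ _ _ finR T P M (pow n Q) (f \o v) tT (genP M (rel_sub tC
    CM)) TQn.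
  move=> h; have [g gE] := lift P h (add_self P).
  by exists (u \o g) => x; rewrite /= vu gE.
by exists n, L, k, (f \o v).
Qed.

End Generator.

Variables P Q : fgmod R.
Hypotheses (progP : progenerator T P) (QP : retract Q P) (CQ : C Q).
Hypothesis genQ : forall M, C M -> generated_by T Q M.

Let TP : T P. Proof. by case: progP. Qed.
Let projP M : T M -> Ext1_zero P M. Proof. by case: progP => _ + _; apply. Qed.
Let genP M : T M -> generated_by T P M. Proof. by case: progP => _ _;
  apply. Qed.
Let projQ M : T M -> Ext1_zero Q M.
Proof. by move=> TM; apply: (Ext1_zero_retract finR QP (projP TM)). Qed.
Let CQn n : C (pow n Q). Proof. exact: (rel_pow finR tT tC n CQ). Qed.

Lemma lift_to_generator M : C M -> exists n (L : fgmod R)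
    (i : {linear L -> pow n Q}) (p : {linear pow n Q -> M}),
  [/\ T L, short_exact i p & forall B (f : {linear B -> M}),
    (forall N, T N -> Ext1_zero B N) ->
    exists g : {linear B -> pow n Q}, forall x, p (g x) = f x].
Proof.
move=> /genQ[n [L [i [p [TL ip]]]]]; exists n, L, i, p; split=> // B f projB.
exact: (Ext1_zero_lift finR f ip (projB L TL)).
Qed.

(** A map from [B] to [Y] in [C] lifts to a power of [Q] over [Y], because the kernel of that
    presentation lies in [T]; the lift then extends along [r]. *)
Lemma left_approx_projective B : (forall N, T N -> Ext1_zero B N) ->
  exists n (g : {linear B -> pow n Q}), left_approx C g.
Proof.
move=> projB; have [n [r rapp]] := hom_coapprox iota_central finR B Q.
exists n, r; split=> // Y f CY.
have [m [L [i [p [TL ip lift]]]]] := lift_to_generator CY.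
have [h hE] := lift B f projB; have [h' h'E] := dsum_colift rapp h.
by exists (p \o h') => x; rewrite /= h'E hE.
Qed.

Lemma twofold_ext_progenerator : exists E, ext_progenerator C E.
Proof.
have [n [g gapp]] := left_approx_projective projP.
have [|E progE] := progenerator_of_left_approx iota_central tT tC TP genP gapp.
  by move=> M CM; apply: Ext1_zero_pow; apply/projQ/(rel_sub tC).
have [CE _ _] := progE; exists E;
  apply: (progenerator_ext (finR := finR)) progE => m.
exact: (rel_pow finR tT tC m CE).
Qed.

Lemma left_approx_of_torsion M : T M ->
  exists N (f : {linear M -> N}), left_approx C f.
Proof.
move=> /genP[n [L [i [p [TL ip]]]]]; have [inji kerp surjp] := ip.
have [|m [g [_ gapp]]] := @left_approx_projective (pow n P).
  by move=> N TN; apply: Ext1_zero_pow; apply: projP.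
(* The pushout is obtained as the quotient [D] of the power of [Q] by the image of [L]. That image
   is a quotient of [L], so it lies in [T], and [D] lies in [C]. *)
have [I [e [j [surje injj je]]]] := image_exists finR (g \o i).
have [D [c [surjc kerc]]] := cokernel_exists finR j.
have jc : short_exact j c by [].
have CD : C D := rel_quot finR tT tC jc (torsion_quot finR tT surje TL) (CQn m).
have [||f fE] := @factor_through_surj R (pow n P) M D p (c \o g).
- exact: surjp.
- by move=> a /kerp[l <-]; apply/kerc; exists (e l); rewrite je.
exists D, f; split=> // Y h CY; have [y yE] := gapp Y (h \o p) CY.
have [||z zE] := @factor_through_surj R (pow m Q) D Y c y.
- exact: surjc.
- move=> q /kerc[b <-]; have [l <-] := surje b.
  rewrite je /= -yE /=; have -> : p (i l) = 0 by apply/kerp; exists l.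
  exact: linear0.
exists z => x; have [x' <-] := surjp x.
by rewrite fE /= zE -yE.
Qed.

(* [D] is [Q^n] modulo the [T]-trace of the kernel [L] of [r]. *)
Lemma right_approx_of_torsion M : T M ->
  (forall N, exists N' (f : {linear N' -> N}), right_approx T f) ->
  exists n (r : {linear pow n Q -> M}) (L N D : fgmod R) (k :
    {linear L -> pow n Q})
         (a : {linear N -> L}) (c : {linear pow n Q -> D}) (f :
           {linear D -> M}),
  [/\ forall f : {linear Q -> M}, exists g :
    {linear Q -> pow n Q}, forall x, r (g x) = f x,
      injective k /\ (forall x, r x = 0 <-> exists l, k l = x),
      right_approx T a,
      surj c /\ (forall x, c x = 0 <-> exists l, k (a l) = x)
    & (forall x, f (c x) = r x) /\ right_approx C f].
Proof.
move=> TM rapT; have [n [r rapp]] := hom_approx iota_central finR Q M.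
have [L [k [injk kerr]]] := kernel_exists finR r.
have [N [a aapp]] := rapT L; have [TN alift] := aapp.
have [D [c [surjc kerc]]] := cokernel_exists finR (k \o a).
have [||f fE] := @factor_through_surj R (pow n Q) D M c r.
- exact: surjc.
- by move=> x /kerc[y <-]; apply/kerr; exists (a y).
have CD : C D.
  have [I [e [j [surje injj je]]]] := image_exists finR (k \o a).
  have jc : short_exact j c.
    split=> // x; split=> [/kerc[y <-]|[z <-]]; first by exists (e y);
      rewrite je.
    by apply/kerc; have [y <-] := surje z; exists y; rewrite je.
  exact: (rel_quot finR tT tC jc (torsion_quot finR tT surje TN) (CQn n)).
exists n, r, L, N, D, k, a, c, f; split=> //; split=> //; split=> // Y h CY.
have [m [L' [i [p [TL' [inji kerp surjp]]]]]] := genQ CY.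
(* Lift [h] on a presentation of [Y] to [s]. The kernel [L'] of the presentation lies in [T] and is
   carried into [L], hence into its trace, which [c] kills; so [c s] descends to [Y]. *)
have [s sE] := dsum_lift rapp (h \o p : {linear dsum m (fun=> Q) -> M}).
have [||t tE] := @factor_through_inj R L (pow n Q) L' k (s \o i).
- exact: injk.
- move=> x; apply/kerr; rewrite /= sE /=.
  have -> : p (i x) = 0 by apply/kerp; exists x.
  exact: linear0.
have [t' t'E] := alift L' t TL'.
have [||g gE] := @factor_through_surj R (pow m Q) Y D p (c \o s).
- exact: surjp.
- move=> x /kerp[z <-]; apply/kerc; exists (t' z).
  by rewrite /= -t'E tE.
exists g => y; have [x <-] := surjp y.
by rewrite gE /= fE sE.
Qed.

Lemma twofold_functorially_finite :
  functorially_finite T -> functorially_finite C.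
Proof.
move=> ffT M; have [[N [f [TN fapp]]] [N' [f' [TN' f'app]]]] := ffT M; split.
  have [X [g [CX gapp]]] := left_approx_of_torsion TN.
  exists X, (g \o f); split=> // Y h CY.
  have [h1 h1E] := fapp Y h (rel_sub tC CY); have [h2 h2E] := gapp Y h1 CY.
  by exists h2 => x; rewrite h1E h2E.
have [||n [r [L [N0 [X [k [a [c [g [_ _ _ _ [_ [CX gapp]]]]]]]]]]]] :=
    @right_approx_of_torsion N'; [exact: TN'|by move=> N0; case: (ffT N0)|].
exists X, (f' \o g); split=> // Y h CY.
have [h1 h1E] := f'app Y h (rel_sub tC CY); have [h2 h2E] := gapp Y h1 CY.
by exists h2 => x; rewrite h1E h2E.
Qed.

(* Extensions lift because [Q^n] is Ext-projective in [T]. *)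
Lemma fac_torsion_class : torsion_class (@full_subcat R)
  (fun M => exists B (p : {linear B -> M}), C B /\ surj p).
Proof.
split=> // [M N [f bf] [B [p [CB surjp]]]|A B X i p [_ _ _ ip]].
  exists B, (f \o p); split=> // y; have [x <-] := bij_surj bf y.
  by have [z <-] := surjp x; exists z.
have [inji kerp surjp] := ip.
split=> [[A' [a [CA' surja]]] [X' [x [CX' surjx]]]|[B' [b [CB' surjb]]]];
  last first.
  exists B', (p \o b); split=> // y; have [z <-] := surjp y.
  by have [w <-] := surjb z; exists w.
have TA : T A := torsion_quot finR tT surja (rel_sub tC CA').
have [n [L [j [q [_ [_ _ surjq]]]]]] := genQ CX'.
have [g gE] := Ext1_zero_lift finR (x \o q) ip (Ext1_zero_pow (finR := finR) (n
  := n) (projQ TA)).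
exists (fg_prod A' (pow n Q)), ((i \o a \o fst) \+ (g \o snd)).
split; first exact: (rel_prod finR tT tC CA' (CQn n)).
move=> y; have [x' x'E] := surjx (p y); have [q' q'E] := surjq x'.
have /kerp[a0 a0E] : p (y - g q') = 0 by rewrite linearB /= gE /= q'E x'E subrr.
have [a' a'E] := surja a0.
by exists (a', q'); rewrite /= a'E a0E subrK.
Qed.

(** * The twofold torsion pair *)

(** The pullback of [f] and [c] is an extension of [Y] by the trace, so it lies in [T]. It maps into
    [L], hence into the trace, and so vanishes in [X]. Used with [L = B] and with a proper [L]. *)
Lemma quotient_by_trace L N B X Y (k : {linear L -> B}) (a : {linear N -> L})
    (c : {linear B -> X}) (f : {linear Y -> X}) :
  injective k -> right_approx T a -> surj c ->
  (forall x, c x = 0 <-> exists l, k (a l) = x) ->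
  T Y -> (forall q y, c q = f y -> exists l, k l = q) ->
  forall y, f y = 0.
Proof.
move=> injk [TN lift] surjc kerc TY fk.
have [I [e [j [surje injj je]]]] := image_exists finR (k \o a).
have jc : short_exact j c.
  split=> // x; split=> [/kerc[y <-]|[z <-]]; first by exists (e y); rewrite je.
  by apply/kerc; have [y <-] := surje z; exists y; rewrite je.
have [Z [i [p [b [ip bi cb]]]]] := short_exact_pullback finR f jc.
have TZ := torsion_ext tT ip (torsion_quot finR tT surje TN) TY.
have [s sE] := factor_through_inj injk (fun z => fk _ _ (cb z)).
have [s' s'E] := lift Z s TZ.
move=> y; have [_ _ /(_ y)[z <-]] := ip; rewrite -cb; apply/kerc.
by exists (s' z); rewrite -s'E sE.
Qed.

(** For the converse, the cokernel of a right [T]-approximation of [M] lies in [right_perp0 T]; so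
    the projection onto it is zero and the approximation is onto. *)
Lemma torsion_left_perp0 M :
  (forall N, exists N' (f : {linear N' -> N}), right_approx T f) ->
  T M <-> left_perp0 (right_perp0 T) M.
Proof.
move=> rapT; split=> [TM N TN|MT]; first exact: TN.
have [N [a aapp]] := rapT M; have [D [c [surjc kerc]]] := cokernel_exists finR
  a.
have TD : right_perp0 T D.
  move=> Y TY f; apply: (@quotient_by_trace M N M D Y idfun a c f) => //.
  by move=> q _ _; exists q.
have [TN _] := aapp; apply: (torsion_quot finR tT (f := a)) TN => x.
by apply/kerc; apply: MT.
Qed.

Lemma rel_left_perp1 M :
  (forall N, exists N' (f : {linear N' -> N}), right_approx T f) ->
  sub_subcat T (fun M => exists B (p : {linear B -> M}), C B /\ surj p) ->
  T M -> left_perp1 (cap_subcat (right_perp0 T) (right_perp1 C)) M -> C M.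
Proof.
move=> rapT facC TM perpM.
have [n [r [L [N [D [k [a [c [f [rapp [injk kerr] aapp [surjc kerc] [fc
  fapp]]]]]]]]]]] :=
  right_approx_of_torsion TM rapT.
have [CD flift] := fapp.
have surjf : surj f.
  have [B [p [CB surjp]]] := facC M TM; have [g gE] := flift B p CB.
  by move=> y; have [x <-] := surjp y; exists (g x).
have [F [j jf]] := short_exact_of_surj finR surjf; have [injj kerf _] := jf.
have F_perp0 : right_perp0 T F.
  move=> Y TY h y; apply: injj; rewrite linear0.
  apply: (@quotient_by_trace L N (pow n Q) D Y k a c (j \o h)) => // q y' cq.
  apply/kerr; rewrite -fc cq /=; apply/kerf; by exists (h y').
(* For an extension [W] of [Q] by [F], extend [j] to [rho : W -> D]. The map [Q -> M] that [f rho]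
   induces lifts through [r] to [g], and [rho - c g p] takes values in [F] and retracts [i]. *)
have QF : Ext1_zero Q F.
  apply: Ext1_zeroI_retraction => W i p ip; have [inji kerp surjp] := ip.
  have [rho rhoE] := Ext1_zero_extend finR j ip (projQ (rel_sub tC CD)).
  have fj x : f (j x) = 0 by apply/kerf; exists x.
  have [||sg sgE] := @factor_through_surj R W Q M p (f \o rho).
  - exact: surjp.
  - by move=> x /kerp[x' <-]; rewrite /= rhoE.
  have [g gE] := rapp sg.
  have [||t tE] := @factor_through_inj R F D W j (rho \- (c \o g \o p)).
  - exact: injj.
  - by move=> x; apply/kerf; rewrite linearB /= fc gE sgE subrr.
  exists t => x; apply: injj; rewrite tE /= rhoE.
  have -> : p (i x) = 0 by apply/kerp; exists x.
  by rewrite !linear0 addr0.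
(* Pass from [Q] to [Y] along a presentation: the lift [g] maps the kernel [L'] into [F], and this
   map is zero because [L'] is in [T]. So [g] descends to a section. *)
have F_perp1 : right_perp1 C F.
  move=> Y CY; apply: Ext1_zeroI_section => W i p ip;
    have [inji kerp surjp] := ip.
  have [m [L' [i' [q [TL' [inji' kerq surjq]]]]]] := genQ CY.
  have [g gE] := Ext1_zero_lift finR q ip (Ext1_zero_pow (finR := finR) (n :=
    m) QF).
  have qi' x : q (i' x) = 0 by apply/kerq; exists x.
  have [||h hE] := @factor_through_inj R F W L' i (g \o i').
  - exact: inji.
  - by move=> x; apply/kerp; rewrite /= gE.
  have [||s sE] := @factor_through_surj R (pow m Q) Y W q g.
  - exact: surjq.
  - move=> x /kerq[x' <-]; have := hE x'; rewrite /= => <-.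
    by rewrite (F_perp0 L' TL' h x') linear0.
  by exists s => y; have [x <-] := surjq y; rewrite sE gE.
have [s sE] := Ext1_zero_section jf (perpM F (conj F_perp0 F_perp1)).
by apply: (rel_retract finR tT tC _ CD); exists s, f.
Qed.

Lemma twofold_pair : functorially_finite T ->
  sub_subcat T (fun M => exists B (p : {linear B -> M}), C B /\ surj p) ->
  twofold_torsion_pair C T
    (cap_subcat (right_perp0 T) (right_perp1 C)) (right_perp0 T).
Proof.
move=> ffT facC; have rapT N := (ffT N).2.
split=> // M; first exact: torsion_left_perp0.
split=> [CM|[/(torsion_left_perp0 _ rapT) TM perpM]];
  last exact: rel_left_perp1.
split; first by apply/torsion_left_perp0 => //; apply: rel_sub tC _ CM.
by move=> N [_]; apply.
Qed.

End TwofoldTorsion.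

Lemma right_perp0_iso_closed (R : nzRingType) (D : subcat R) :
  iso_closed (right_perp0 D).
Proof.
move=> M M' [f /linear_inverse[g [_ gK]]] DM N DN h x.
by have /= gh0 := DM N DN (g \o h) x; rewrite -[h x]gK gh0 linear0.
Qed.

Lemma twofold_torsion_class_finite_dimensional (K : fieldType) (R : nzRingType)
    (iota : {rmorphism K -> R}) (C : subcat R) :
  (forall k r, iota k * r = r * iota k) ->
  (exists n (b : 'I_n -> R),
     forall r, exists c : 'I_n -> K, r = \sum_(i < n) iota (c i) * b i) ->
  twofold_torsion_class C -> functorially_finite (T1 C) -> condition_star C ->
  [/\ functorially_finite C,
      exists F1 F2 : subcat R,
        [/\ iso_closed F1, iso_closed F2
          & twofold_torsion_pair C (T1 C) F2 F1]
    & exists P : fgmod R, ext_progenerator C P].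
Proof.
move=> iota_central finR tfC ffT starC.
have tT := T1_torsion_class C; have tC := twofold_T1 tfC.
(* The empty class satisfies [torsion_class]; if [C] were empty, [T1 C] would be empty too and could
   not contain an approximation. *)
have C_nonempty : exists M, C M.
  apply: contrapT => C0; have [_ [N [_ [TN _]]]] := ffT (fg_zero R).
  suff : False by [].
  apply: (TN (fun=> False)); first by split=> // A B X i p _; split.
  by move=> M CM; apply: C0; exists M.
have [P [basicP progP]] := basic_progenerator iota_central tT (ff_progenerator
  iota_central finR tT ffT).
have extP : ext_progenerator (T1 C) P.
  have [TP _ _] := progP; apply: (progenerator_ext (finR := finR)) progP => n.
  exact: (torsion_pow finR tT n TP).
have [Q [QP CQ genQ]] := add_generator iota_central tT tC progP C_nonempty
  (starC P basicP extP).
split.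
- exact: (twofold_functorially_finite iota_central tT tC progP CQ genQ ffT).
- exists (right_perp0 (T1 C)), (cap_subcat (right_perp0 (T1 C)) (right_perp1
  C)); split.
  + exact: right_perp0_iso_closed.
  + move=> M N MN [M0 M1]; split; first exact: right_perp0_iso_closed MN M0.
    move=> X CX; exact: (Ext1_zero_isom_r finR MN (M1 X CX)).
  + apply: (twofold_pair iota_central tT tC progP QP CQ genQ) => //.
    (* The quotients of objects of [C] form a torsion class containing [C], so they exhaust
       [T1 C]. *)
    apply: (T1_min (fac_torsion_class tT tC progP QP CQ genQ)) => M CM.
    by exists M, idfun; split=> // y; exists y.
- exact: (twofold_ext_progenerator iota_central tT tC progP QP CQ genQ).
Qed.

Theorem theorem1p10 (K : closedFieldType) (Lambda : falgType K)
    (C : subcat (Lambda^c)%type) :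
  twofold_torsion_class C ->
  functorially_finite (T1 C) ->
  condition_star C ->
  [/\ functorially_finite C,
      exists F1 F2 : subcat (Lambda^c)%type,
        [/\ iso_closed F1, iso_closed F2
          & twofold_torsion_pair C (T1 C) F2 F1]
    & exists P : fgmod (Lambda^c)%type, ext_progenerator C P].
Proof.
pose R : nzRingType := (Lambda^c)%type.
(* Scalar multiples of the unit are central, so they embed [K] into the converse ring as well. *)
have iotaM : monoid_morphism (fun k : K => (k%:A : R)).
  split=> [|a b]; first exact: scale1r.
  by rewrite /GRing.mul /= -scalerAl -scalerAr mulr1 scalerA mulrC.
have iotaB : zmod_morphism (fun k : K => (k%:A : R)).
  by move=> a b; rewrite scalerBl.
pose iota : {rmorphism K -> R} := HB.pack (fun k : K => (k%:A : R))
  (GRing.isZmodMorphism.Build K R _ iotaB) (GRing.isMonoidMorphism.Build K R _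
    iotaM).
have iota_central k (r : R) : iota k * r = r * iota k.
  by rewrite /GRing.mul /= -scalerAl -scalerAr mulr1 mul1r.
have finR : exists n (b : 'I_n -> R),
    forall r, exists c : 'I_n -> K, r = \sum_(i < n) iota (c i) * b i.
  exists (\dim {:Lambda}), (fun i => (vbasis {:Lambda})`_i) => r.
  exists (fun i => coord (vbasis {:Lambda}) i r).
  rewrite {1}(coord_vbasis (memvf r)); apply: eq_bigr => i _.
  by rewrite [RHS]/GRing.mul /= -scalerAr mulr1.
exact: (twofold_torsion_class_finite_dimensional iota_central finR).
Qed.
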